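(* Let $r\ge2$ be a fixed integer, and let $k=k_n$ satisfy $k=\Omega(\sqrt n)$ and $k\le\frac23 n$. Let $\theta$ be uniformly distributed on $\Theta_k=\{v\in\{0,1\}^n:\|v\|_0=k\}$, and observe $Y=\frac{\lambda}{k^{r/2}}\theta^{\otimes r}+W$, where $W\in(\mathbb R^n)^{\otimes r}$ has i.i.d. $\mathcal N(0,1)$ entries independent of $\theta$. If $$\lambda=\tilde\Omega\!\left(\frac{n^{(r-1)/2}}{k^{r/2-1}}\right),$$ (i.e. $\lambda\ge L(n)\,n^{(r-1)/2}/k^{r/2-1}$ for a suitable polylogarithmic factor $L(n)$), then with probability $1-o(1)$ as $n\to\infty$, the Greedy Local Search (peeling) algorithm with input $Y$ outputs a vector $\sigma\in\{0,1\}^n$ satisfying $\|\sigma\|_0\le\frac32k$ and $\langle\sigma,\theta\rangle\ge\frac18k$.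
   Context: Notation: $\|v\|_0$ is the number of nonzero entries, $e_i$ is the $i$-th standard basis vector, $\langle\cdot,\cdot\rangle$ is the entrywise inner product of tensors. Greedy Local Search (peeling) algorithm, input $Y$: let $Q=\max\{Y,0\}$ entrywise. Let $P^0=\mathbf 1\in\mathbb R^n$ (all-ones vector). For $t=0,1,\dots,n-\frac32k-1$: find $\ell\in\arg\min_{i:\,P^t_i=1}\langle e_i\otimes(P^t)^{\otimes(r-1)},Q\rangle$, and let $P^{t+1}$ be $P^t$ with its $\ell$-th coordinate set to $0$. Output $P^{n-\frac32k}$ (if $\frac32k$ is not an integer, it is replaced by $\lfloor\frac32k\rfloor$ in the number of steps). *)

(* Defs.v *)
From HB Require Import structures.
From mathcomp Require Import all_boot all_order all_algebra.
From mathcomp Require Import all_classical all_reals all_analysis.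

Set Implicit Arguments.
Unset Strict Implicit.
Unset Printing Implicit Defensive.

Import Order.TTheory GRing.Theory Num.Theory.
Import numFieldNormedType.Exports.

Local Open Scope classical_set_scope.
Local Open Scope ring_scope.

(* Vectors of {0,1}^n; [true] is the coordinate value 1. *)
Definition binvec (n : nat) := {ffun 'I_n -> bool}.

Definition l0norm (n : nat) (v : binvec n) : nat := #|[set i | v i]%SET|.

Definition Theta (n k : nat) : {set binvec n} := [set v | l0norm v == k]%SET.

Section Tensors.
Variable R : realType.

Definition vec (n : nat) (v : binvec n) : 'rV[R]_n := \row_i (v i)%:R.

Definition dotv (n : nat) (u v : 'rV[R]_n) : R := \sum_i u 0 i * v 0 i.

Definition tensor (r n : nat) := {ffun r.-tuple 'I_n -> R}.

(* v_0 (x) v_1 (x) ... (x) v_(r-1) *)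
Definition outer (r n : nat) (v : 'I_r -> 'rV[R]_n) : tensor r n :=
  [ffun t : r.-tuple 'I_n => \prod_(j < r) v j 0 (tnth t j)].

Definition tpow (r n : nat) (v : 'rV[R]_n) : tensor r n := outer (fun=> v).

(* e_i (x) v^{(x)(r-1)} : the factor e_i is in the first slot. *)
Definition unit_tpow (r n : nat) (i : 'I_n) (v : 'rV[R]_n) : tensor r n :=
  outer (fun j : 'I_r => if nat_of_ord j == 0%N then delta_mx 0 i else v).

Definition dott (r n : nat) (A B : tensor r n) : R := \sum_t A t * B t.

Definition pos_part (r n : nat) (Y : tensor r n) : tensor r n :=
  [ffun t => Num.max (Y t) 0].

Definition peel_step (r n : nat) (Q : tensor r n) (p p' : binvec n) : Prop :=
  exists l : 'I_n,
    [/\ p l,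
        forall i, p i ->
          dott (unit_tpow r l (vec p)) Q <= dott (unit_tpow r i (vec p)) Q
      & p' = [ffun i => if i == l then false else p i]].

(* s is the output of some run of the algorithm on input Y with parameter k;
   argmin ties are broken arbitrarily; there are n - floor(3k/2) steps. *)
Definition peeling_output (r n k : nat) (Y : tensor r n) (s : binvec n) : Prop :=
  let N := (n - (3 * k) %/ 2)%N in
  exists p : nat -> binvec n,
    [/\ p 0%N = [ffun=> true],
        forall t, (t < N)%N -> peel_step (pos_part Y) (p t) (p t.+1)
      & s = p N].

Definition polylogarithmic (L : nat -> R) : Prop :=
  exists a : nat, (L : nat -> R^o) =O_\oo (fun n => (ln n%:R ^+ a : R^o)).

End Tensors.

Section RandomVariables.
Context d (T : measurableType d) (R : realType) (P : probability T R).

Definition uniform_on (F : finType) (A : {set F}) (X : T -> F) : Prop :=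
  (forall x, measurable (X @^-1` [set x])) /\
  (forall x, x \in A -> P (X @^-1` [set x]) = (#|A|%:R^-1)%:E).

(* Only measurable sets: [normal_prob 0 1] is not meaningful on other sets. *)
Definition std_normal (X : {RV P >-> R}) : Prop :=
  forall B : set R, measurable B -> P (X @^-1` B) = normal_prob 0 1 B.

Definition mutually_independent (I : finType) (X : I -> {RV P >-> R}) : Prop :=
  forall (J : {set I}) (B : I -> set R),
    (forall i, i \in J -> measurable (B i)) ->
    P (\bigcap_(i in [set` J]) (X i @^-1` B i)) =
    (\prod_(i in J) P (X i @^-1` B i))%E.

Definition sigma_gen (I : Type) (X : I -> {RV P >-> R}) : set_system T :=
  <<s \bigcup_i preimage_set_system setT (X i) measurable >>.

(* Independence of X from the whole family (Y i)_i. *)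
Definition independent_of (F : finType) (X : T -> F)
    (I : Type) (Y : I -> {RV P >-> R}) : Prop :=
  forall (A : set F) (E : set T), sigma_gen Y E ->
    P (X @^-1` A `&` E) = (P (X @^-1` A) * P E)%E.

End RandomVariables.

(* Y = lambda / k^(r/2) * theta^{(x) r} + W. *)
Definition observation (R : realType) (r n k : nat) (lam : R)
    (theta : binvec n) (W : tensor R r n) : tensor R r n :=
  [ffun t => lam / (k%:R `^ (r%:R / 2)) * tpow r (vec R theta) t + W t].

(* Main.v *)
(** Let v be the planted set.  The score of i only reads the entries whose first
    index is i, so the scores of planted and of non-planted indices are
    independent.  Consider the ghost run, which peels like the algorithm but
    never removes a planted index: the sets p that it visits are independent of
    the rows of the planted indices, hence a union bound over the n sets visited
    (instead of 2^n) shows that the noise in every planted row is at least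
    - O(log n) n^((r-1)/2) below its mean.  On the other side, a union bound over
    all p containing v shows that the average noise of the non-planted rows is
    at most O(1) n^((r-1)/2) above the mean, as long as |p| > 3k/2.  The signal adds
    at least (lambda / k^(r/2)) k^(r-1) / 4 to each planted score, so the smallest
    score is never planted: the algorithm follows the ghost run and its output
    contains all of v.  Ties at a positive value have probability zero, and ties
    at zero cannot matter: the ghost states in which all non-planted scores are
    positive do not depend on how ties at zero are broken. *)
Require Import Defs.
From HB Require Import structures.
From mathcomp Require Import all_boot all_order all_algebra.
From mathcomp Require Import all_classical all_reals all_analysis.
From mathcomp Require Import measurable_realfun.
From mathcomp Require Import ring lra zify.
Import Order.TTheory GRing.Theory Num.Theory.
Import numFieldNormedType.Exports.
Local Open Scope classical_set_scope.
Local Open Scope ring_scope.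

Set Implicit Arguments.
Unset Strict Implicit.
Unset Printing Implicit Defensive.

(** * Extending independence from pi-systems to sigma-algebras *)

Section Independence.
Context d (T : measurableType d) (R : realType) (P : probability T R).
Implicit Types (G H : set_system T) (A E : set T).

(** Both sides are finite measures in [A]: [P] restricted to [E], and [P] scaled by the mass of [E].
    They agree on a pi-system containing the whole space, so uniqueness of measures applies. *)
Lemma pi_system_indep G E : setI_closed G -> G setT -> G `<=` measurable ->
  measurable E ->
  (forall A, G A -> P (A `&` E) = (P A * P E)%E) ->
  forall A, <<s G >> A -> P (A `&` E) = (P A * P E)%E.
Proof.
move=> GI GT Gm mE GE A sA.
have PE0 : (0 <= fine (P E))%R by rewrite fine_ge0// measure_ge0.
pose m1 := mrestr P mE; pose m2 := mscale (NngNum PE0) P.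
have m2E B : m2 B = (P B * P E)%E.
  by rewrite /m2 /mscale /= fineK ?fin_num_measure// muleC.
rewrite -m2E.
apply: (g_sigma_algebra_measure_unique G Gm (fun=> setT) _ _ m1 m2) => //.
- by rewrite bigcup_const//; exists 0%N.
- by move=> B GB; rewrite [RHS]m2E; exact: GE.
- by move=> _; rewrite /m1 /= /mrestr setTI ltey_eq fin_num_measure.
Qed.

Lemma pi_systems_indep G H : setI_closed G -> G setT -> G `<=` measurable ->
  setI_closed H -> H setT -> H `<=` measurable ->
  (forall A B, G A -> H B -> P (A `&` B) = (P A * P B)%E) ->
  forall A B, <<s G >> A -> <<s H >> B -> P (A `&` B) = (P A * P B)%E.
Proof.
move=> GI GT Gm HI HT Hm GH A B sA sB.
have sGm : <<s G >> `<=` measurable.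
  by apply: smallest_sub => //; exact: sigma_algebra_measurable.
rewrite setIC muleC; apply: (@pi_system_indep H) => //; first exact: sGm.
move=> C HC; rewrite setIC muleC; apply: (@pi_system_indep G) => //.
  exact: Hm.
by move=> D GD; exact: GH.
Qed.

Context {d1 d2} {T1 : measurableType d1} {T2 : measurableType d2}.
Variables (X : {mfun T >-> T1}) (Z : {mfun T >-> T2}).
Hypothesis XZ : forall (A : set T1) (B : set T2), measurable A -> measurable B ->
  P (X @^-1` A `&` Z @^-1` B) = (P (X @^-1` A) * P (Z @^-1` B))%E.

(** Independence makes the law of the pair the product of the laws, so Tonelli allows fixing the
    value of [X] first; this takes the place of conditioning. *)
Lemma indep_fubini (F : T1 * T2 -> \bar R) :
  measurable_fun [set: T1 * T2] F -> (forall u, (0 <= F u)%E) ->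
  (\int[P]_w F (X w, Z w) =
   \int[distribution P X]_x \int[distribution P Z]_z F (x, z))%E.
Proof.
move=> mF F0.
have mXZ : measurable_fun setT (fun w => (X w, Z w)).
  by apply: measurable_fun_pair.
pose XZm : {mfun T >-> (T1 * T2)%type} := mfun_Sub (mem_set mXZ).
rewrite -(@fubini_tonelli1 _ _ _ _ _ (distribution P X) (distribution P Z) F mF F0).
transitivity (\int[distribution P XZm]_u F u)%E.
  by rewrite ge0_integral_distribution.
apply: eq_measure_integral => A mA _.
by apply/esym/product_measure_unique.
Qed.

End Independence.

(** * Sigma-algebras generated by subfamilies of random variables *)

Section Cylinders.
Context d (T : measurableType d) (R : realType) (P : probability T R).
Context (I : finType) (X : I -> {RV P >-> R}).
Implicit Types (J : {set I}).

(** Intersections of preimages rather than single preimages: closure under intersection is what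
    uniqueness of measures needs. *)
Definition cylinders J : set_system T :=
  [set A | exists2 B : I -> set R, (forall i, measurable (B i)) &
    A = \bigcap_(i in [set` J]) X i @^-1` B i].

(** The carrier is still [T], with a coarser sigma-algebra. Measurability over [sub_algebra J]
    expresses that a function depends only on the variables indexed by [J]. *)
Definition sub_algebra J := g_sigma_algebraType (cylinders J).

HB.instance Definition _ J := Measurable.on (sub_algebra J).

Lemma cylinders_setI J : setI_closed (cylinders J).
Proof.
move=> _ _ [A mA ->] [B mB ->]; exists (fun i => A i `&` B i).
  by move=> i; exact: measurableI.
by rewrite -bigcapI.
Qed.

Lemma cylinders_setT J : cylinders J setT.
Proof.
exists (fun=> setT) => //; apply/esym; rewrite -subTset => w _ i _ //.
Qed.

Lemma cylinders_preimage J i (B : set R) : i \in J -> measurable B ->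
  cylinders J (X i @^-1` B).
Proof.
move=> iJ mB; exists (fun j => if j == i then B else setT).
  by move=> j; case: ifP.
apply/seteqP; split => w /=.
  by move=> Bw j _; rewrite /preimage /=; case: eqP => [->|].
by move=> /(_ i iJ); rewrite /preimage /= eqxx.
Qed.

Lemma cylinders_measurable J : cylinders J `<=` measurable.
Proof.
move=> _ [B mB ->]; apply: fin_bigcap_measurable => // i _.
by rewrite -[X in measurable X]setTI; exact: measurable_funP.
Qed.

Lemma sub_algebra_measurable J (A : set (sub_algebra J)) :
  measurable A -> measurable (A : set T).
Proof.
apply: smallest_sub; first exact: sigma_algebra_measurable.
exact: cylinders_measurable.
Qed.

Lemma sub_algebra_sigma_gen J (A : set (sub_algebra J)) :
  measurable A -> sigma_gen X A.
Proof.
apply: smallest_sub; first exact: smallest_sigma_algebra.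
move=> _ [B mB ->].
pose TX : measurableType _ := g_sigma_algebraType
  (\bigcup_i preimage_set_system setT (X i) measurable).
apply: (@fin_bigcap_measurable _ TX) => // i _.
apply: sub_sigma_algebra; exists i => //; exists (B i) => //.
by rewrite setTI.
Qed.

Lemma measurable_sub_algebra J i : i \in J ->
  measurable_fun [set: sub_algebra J] (X i : sub_algebra J -> R).
Proof.
move=> iJ _ B mB; rewrite setTI.
by apply: sub_sigma_algebra; exact: cylinders_preimage.
Qed.

Lemma sub_algebra_measurable_fun d' (U : measurableType d') J
    (f : sub_algebra J -> U) :
  measurable_fun setT f -> measurable_fun setT (f : T -> U).
Proof.
move=> mf _ B mB; apply: (@sub_algebra_measurable J); exact: mf.
Qed.

Hypothesis indX : mutually_independent X.

(** Constraints on disjoint index sets glue to one cylinder over the union, where mutual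
    independence factorises. The pi-system argument carries the product formula to the generated
    sigma-algebras. *)
Lemma sub_algebra_indep J1 J2 (A : set (sub_algebra J1))
    (B : set (sub_algebra J2)) : [disjoint J1 & J2]%B ->
  measurable A -> measurable B -> P (A `&` B) = (P A * P B)%E.
Proof.
move=> dJ mA mB.
apply: (pi_systems_indep (@cylinders_setI J1) (cylinders_setT J1)
  (@cylinders_measurable J1) (@cylinders_setI J2) (cylinders_setT J2)
  (@cylinders_measurable J2)) => // _ _ [E mE ->] [F mF ->].
pose G i := if i \in J1 then E i else F i.
have J21 i : i \in J2 -> i \in J1 = false.
  exact: disjointFl dJ.
have EG : \bigcap_(i in [set` J1]) X i @^-1` E i =
          \bigcap_(i in [set` J1]) X i @^-1` G i.
  by apply: eq_bigcapr => i /= iJ; rewrite /G iJ.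
have FG : \bigcap_(i in [set` J2]) X i @^-1` F i =
          \bigcap_(i in [set` J2]) X i @^-1` G i.
  by apply: eq_bigcapr => i /= iJ; rewrite /G J21.
have mG i : measurable (G i) by rewrite /G; case: ifP.
rewrite EG FG -bigcap_setU (_ : _ `|` _ = [set` (J1 :|: J2)%SET]); last first.
  by apply/seteqP; split => i /=; rewrite inE => /orP.
rewrite !indX//.
by rewrite (eq_bigl [predU J1 & J2]) ?bigU// => i; rewrite !inE.
Qed.

Lemma sub_algebra_indep_fun d1 d2 (T1 : measurableType d1)
    (T2 : measurableType d2) J1 J2 (f : T -> T1) (g : T -> T2) :
  [disjoint J1 & J2]%B ->
  measurable_fun setT (f : sub_algebra J1 -> T1) ->
  measurable_fun setT (g : sub_algebra J2 -> T2) ->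
  forall (A : set T1) (B : set T2), measurable A -> measurable B ->
  P (f @^-1` A `&` g @^-1` B) = (P (f @^-1` A) * P (g @^-1` B))%E.
Proof.
move=> dJ mf mg A B mA mB; apply: sub_algebra_indep (dJ) _ _.
  by rewrite -[X in measurable X]setTI; exact: mf.
by rewrite -[X in measurable X]setTI; exact: mg.
Qed.

End Cylinders.

(** * Null diagonals, products and Chernoff bounds for independent variables *)

Section Independent_sums.
Context d (T : measurableType d) (R : realType) (P : probability T R).
Context (I : finType) (X : I -> {RV P >-> R}).
Hypothesis indX : mutually_independent X.
Implicit Types (J : {set I}).

Lemma measurable_sub_algebra_comp J (f : R -> R) i : i \in J ->
  measurable_fun setT f ->
  measurable_fun setT (fun w : sub_algebra X J => f (X i w)).
Proof.
by move=> iJ mf; apply: measurableT_comp => //; exact: measurable_sub_algebra.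
Qed.

Lemma measurable_sub_algebra_sum J (A : {set I}) (f : R -> R) :
  A \subset J -> measurable_fun setT f ->
  measurable_fun setT (fun w : sub_algebra X J => \sum_(i in A) f (X i w)).
Proof.
move=> AJ mf.
under eq_fun do rewrite big_mkcond.
apply: measurable_sum => i; have [iA|_ //] := boolP (i \in A).
apply: measurable_sub_algebra_comp => //; exact: (fintype.subsetP AJ).
Qed.

(** [f'] and [g'] are [f] and [g] bundled as random variables on [T], so that their laws can be
    named. *)
Lemma sub_algebra_fubini (J1 J2 : {set I}) (f g : T -> R)
    (F : R * R -> \bar R) : [disjoint J1 & J2]%B ->
  measurable_fun setT (f : sub_algebra X J1 -> R) ->
  measurable_fun setT (g : sub_algebra X J2 -> R) ->
  measurable_fun setT F -> (forall u, (0 <= F u)%E) ->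
  exists f' g' : {RV P >-> R}, [/\ f' =1 f, g' =1 g &
  (\int[P]_w F (f w, g w) =
   \int[distribution P f']_x \int[distribution P g']_y F (x, y))%E].
Proof.
move=> dJ mf mg mF F0.
have ind := @sub_algebra_indep_fun _ _ _ _ _ _ indX _ _ _ _ J1 J2 f g dJ mf mg.
pose f' : {RV P >-> R} := mfun_Sub (mem_set (sub_algebra_measurable_fun mf)).
pose g' : {RV P >-> R} := mfun_Sub (mem_set (sub_algebra_measurable_fun mg)).
by exists f', g'; split => //; rewrite -(@indep_fubini _ _ _ _ _ _ _ _ f' g').
Qed.

(* Given Z, the diagonal event says that X i takes a prescribed value. *)
Lemma null_diagonal J i (Z : T -> R) : i \notin J ->
  measurable_fun setT (Z : sub_algebra X J -> R) ->
  (forall x, P (X i @^-1` [set x]) = 0%E) ->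
  P [set w | Z w = X i w] = 0%E.
Proof.
move=> iJ mZ X0.
pose E : set (R * R) := [set u | u.1 = u.2].
have mE : measurable E.
  rewrite (_ : E = (fun u => u.1 - u.2) @^-1` [set 0]).
    rewrite -[X in measurable X]setTI.
    by apply: (measurable_funB measurable_fst measurable_snd).
  apply/seteqP; split => u /=; first by rewrite /E /= => ->; rewrite subrr.
  by move=> /eqP; rewrite subr_eq0 => /eqP.
have mF : measurable_fun setT (fun u => (\1_E u)%:E : \bar R).
  exact/measurable_EFinP/measurable_indic.
have mXi : measurable_fun setT (X i : sub_algebra X [set i]%SET -> R).
  by apply: measurable_sub_algebra; rewrite inE.
have dJ : [disjoint J & [set i]%SET]%B by rewrite disjoint_sym disjoints1.
have [Z' [X' [ZZ XX intE]]] := sub_algebra_fubini dJ mZ mXi mF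
  (fun u => ler0n _ _ : (0 <= (\1_E u)%:E)%E).
have mD : measurable [set w | Z w = X i w].
  rewrite (_ : [set w | _] = (Z' \- X') @^-1` [set 0]).
    rewrite -[X in measurable X]setTI.
    by apply: (measurable_funB (measurable_funPT Z') (measurable_funPT X')).
  apply/seteqP; split => u /=; rewrite ZZ XX; first by move=> ->; rewrite subrr.
  by move=> /eqP; rewrite subr_eq0 => /eqP.
rewrite -[X in P X]setIT -integral_indic//.
rewrite [LHS](_ : _ = \int[P]_w (\1_E (Z w, X i w))%:E)%E; last first.
  by apply: eq_integral => w _; rewrite !indicE /E; congr (_%:R%:E); rewrite !in_setE.
rewrite intE integral0_eq// => x _.
(* For fixed [x] the section of the diagonal is the single point [x], to which the law of [X i]
   gives no mass. *)
rewrite (_ : (fun y => (\1_E (x, y))%:E) = (fun y => (\1_[set x] y)%:E)).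
  rewrite integral_indic//= setIT.
  have -> : distribution P X' [set x] = P (X i @^-1` [set x]).
    by congr (P _); apply/seteqP; split => w; rewrite /preimage /= XX.
  exact: X0.
apply/funext => y; rewrite !indicE /E; congr ((nat_of_bool _)%:R%:E).
by apply/idP/idP; rewrite !inE /= => ->.
Qed.

Lemma integral_indep_mul (J1 J2 : {set I}) (f g : T -> R) :
  [disjoint J1 & J2]%B ->
  measurable_fun setT (f : sub_algebra X J1 -> R) ->
  measurable_fun setT (g : sub_algebra X J2 -> R) ->
  (forall w, 0 <= f w) -> (forall w, 0 <= g w) ->
  (\int[P]_w (f w * g w)%:E = (\int[P]_w (f w)%:E) * \int[P]_w (g w)%:E)%E.
Proof.
move=> dJ mf mg f0 g0.
(* Absolute values make the integrand nonnegative on the whole plane, as Tonelli requires; they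
   change nothing on the values of [f] and [g]. *)
pose F (u : R * R) := (`|u.1| * `|u.2|)%:E.
have mF : measurable_fun setT F.
  by apply/measurable_EFinP/measurable_funM; exact: measurableT_comp.
have F0 u : (0 <= F u)%E by rewrite lee_fin mulr_ge0.
have [f' [g' [ff gg intE]]] := sub_algebra_fubini dJ mf mg mF F0.
rewrite [LHS](_ : _ = \int[P]_w F (f w, g w))%E; last first.
  by apply: eq_integral => w _; rewrite /F /= !ger0_norm.
rewrite intE.
have E (h : T -> R) (h' : {RV P >-> R}) : (forall w, 0 <= h w) -> h' =1 h ->
  (\int[P]_w (h w)%:E = \int[distribution P h']_x `|x|%:E)%E.
  move=> h0 hh; rewrite ge0_integral_distribution//=.
  - by apply: eq_integral => w _ /=; rewrite hh ger0_norm.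
  - exact/measurable_EFinP.
rewrite (E f f')// (E g g')// /F.
have ex h : measurable_fun [set: R] (fun y : R => `|y|%:E) by exact/measurable_EFinP.
transitivity (\int[distribution P f']_x
    (`|x|%:E * \int[distribution P g']_y `|y|%:E))%E.
  apply: eq_integral => x _; by rewrite -ge0_integralZl//=; exact: ex.
by rewrite ge0_integralZr//; [exact: ex|exact: integral_ge0].
Qed.

(** The list has no duplicates, so the head variable is independent of the product over the tail and
    the bounds multiply by induction. *)
Lemma integral_prod_le (g : R -> R) (M : R) (s : seq I) :
  measurable_fun setT g -> (forall x, 0 <= g x) -> 0 <= M -> uniq s ->
  (forall i, (\int[P]_w (g (X i w))%:E <= M%:E)%E) ->
  (\int[P]_w (\prod_(i <- s) g (X i w))%:E <= (M ^+ size s)%:E)%E.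
Proof.
move=> mg g0 M0 us gM.
elim: s us => [|i s IH] /=.
  under eq_integral do rewrite big_nil.
  by rewrite integral_cst//= probability_setT mul1e expr0.
move=> /andP[si us].
under eq_integral do rewrite big_cons.
rewrite (@integral_indep_mul [set i]%SET [set j in s]%SET)//.
- by rewrite exprS EFinM lee_pmul// ?IH//; apply: integral_ge0 => w _;
    rewrite lee_fin// prodr_ge0.
- by rewrite disjoints1 inE.
- by apply: measurable_sub_algebra_comp; rewrite ?inE.
- apply: measurable_prod => j js; apply: measurable_sub_algebra_comp => //.
  by rewrite inE.
- by move=> w; rewrite prodr_ge0.
Qed.

(** Markov's inequality for the exponential of [s] times the sum, whose expectation is a product of
    at most [#|J|] factors [expR C] by independence. *)
Lemma chernoff_sum (f : R -> R) (J : {set I}) (s C a : R) :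
  measurable_fun setT f -> 0 < s ->
  (forall i, (\int[P]_w (expR (s * f (X i w)))%:E <= (expR C)%:E)%E) ->
  (P [set w | (a <= \sum_(i in J) f (X i w))%R] <=
    (expR (#|J|%:R * C - s * a))%:E)%E.
Proof.
move=> mf s0 hM.
have mS : measurable_fun setT (fun w => \sum_(i in J) f (X i w)).
  apply: (@sub_algebra_measurable_fun _ _ _ _ _ X _ _ J).
  exact: measurable_sub_algebra_sum.
pose S : {RV P >-> R} := mfun_Sub (mem_set mS).
apply: le_trans (chernoff S a s0) _.
rewrite expRD EFinM -mulNr; apply: lee_pmul => //.
- by apply: expectation_ge0 => w; exact: expR_ge0.
- rewrite /mmt_gen_fun expectation.unlock expRM_natl cardE.
  under eq_integral.
    move=> w _ /=; rewrite [X in expR X](_ : _ = \sum_(i <- enum J) s * f (X i w)).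
      rewrite expR_sum; over.
    by rewrite big_enum /= mulrC mulr_sumr.
  apply: (integral_prod_le (g := fun x => expR (s * f x))) => //.
  all: try exact: enum_uniq.
  + by apply: measurableT_comp => //; exact: measurable_funM.
  all: by move=> *; exact: expR_ge0.
Qed.

End Independent_sums.

(** * Exponential moments of the standard normal law *)

Section Gaussian.
Context (R : realType).
Let nu : probability (measurableTypeR R) R := normal_prob (0 : R) 1.
Notation mu := (@lebesgue_measure R).

(** The linear term is exact, so it disappears on integrating a centered variable, and the remainder
    is [s ^+ 2] times a function free of [s]. *)
Lemma expR_le_quadratic (s y : R) : 0 <= s <= 1 ->
  expR (s * y) <= 1 + s * y + s ^+ 2 * (16 * expR (2 * `|y|)).
Proof.
move=> /andP[s0 s1].
have y2 : y ^+ 2 <= 2 * expR `|y|.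
  have := @expR_ge1Dxn R `|y| 1 (normr_ge0 _).
  rewrite real_normK ?num_real// (_ : 2`!%:R = 2)//; lra.
suff : expR (s * y) <= 1 + s * y + 8 * (s * y) ^+ 2 * expR `|y|.
  move=> /le_trans; apply; rewrite lerD2l exprMn.
  have -> : expR (2 * `|y|) = expR `|y| * expR `|y|.
    by rewrite -expRD mulr_natl mulr2n.
  have := expR_gt0 `|y|; have s20 := sqr_ge0 s.
  move=> e0; rewrite [leLHS](_ : _ = s ^+ 2 * (8 * y ^+ 2 * expR `|y|)); last ring.
  by apply: ler_wpM2l => //; nra.
have sy : `|s * y| <= `|y|.
  by rewrite normrM ger0_norm// ler_piMl.
have E : expR `|s * y| <= expR `|y| by rewrite ler_expR.
set z := s * y in sy E *; move: E; set e := expR `|y| => E.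
(* For small [z], compare with 1 / (1 - z). Otherwise the quadratic term is at least [2 * e], which
   covers both [expR z] and a negative [1 + z]. *)
have [z2|z2] := leP `|z| (1 / 2).
  have e1 : 1 <= e by rewrite -(@expR0 R) ler_expR.
  have [zl zu] : - (1/2) <= z /\ z <= 1/2 by move: z2; rewrite ler_norml => /andP[].
  apply: (@le_trans _ _ (1 - z)^-1).
    rewrite -[z]opprK expRN opprK lef_pV2 ?posrE ?expR_gt0 ?subr_gt0//; last lra.
    exact: expR_ge1Dx.
  rewrite -[_^-1]mul1r ler_pdivrMr ?subr_gt0; last lra.
  have : 8 * z ^+ 2 * 1 <= 8 * z ^+ 2 * e by apply: ler_wpM2l => //; nra.
  nra.
have ez : expR z <= expR `|z| by rewrite ler_expR ler_norm.
have z1 : 1 + `|z| <= e by apply: le_trans E; exact: expR_ge1Dx.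
have zl : - `|z| <= z by rewrite lerNl -normrN ler_norm.
have : 2 * e <= 8 * z ^+ 2 * e.
  apply: ler_wpM2r; first by have := normr_ge0 z; lra.
  rewrite -[z ^+ 2]real_normK ?num_real//; nra.
lra.
Qed.

(** The Radon-Nikodym derivative of [nu] and the Gaussian density have equal integrals over
    measurable sets, hence agree almost everywhere; the change of variables holds for the former. *)
Lemma ge0_integral_normal_prob (f : R -> \bar R) :
  measurable_fun setT f -> (forall x, (0 <= f x)%E) ->
  (\int[nu]_x f x = \int[mu]_x (f x * (normal_pdf 0 1 x)%:E))%E.
Proof.
move=> mf f0.
have dom : nu `<< mu := normal_prob_dominates 0 1.
rewrite -(Radon_Nikodym_SigmaFinite.change_of_variables dom f0)//.
have mp : measurable_fun setT (fun x : R => (normal_pdf 0 1 x)%:E).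
  by apply/measurable_EFinP; exact: measurable_normal_pdf.
have mf' := measurable_int mu (Radon_Nikodym_SigmaFinite.f_integrable dom).
apply: ge0_ae_eq_integral => //.
- exact: emeasurable_funM.
- exact: emeasurable_funM.
- by move=> x _; rewrite mule_ge0// Radon_Nikodym_SigmaFinite.f_ge0.
- by move=> x _; rewrite mule_ge0// lee_fin normal_pdf_ge0.
apply: ae_eqe_mul2l; apply: integral_ae_eq => //.
  exact: Radon_Nikodym_SigmaFinite.f_integrable.
by move=> E _ mE; rewrite -Radon_Nikodym_SigmaFinite.f_integral.
Qed.

Lemma normal_prob_set1 (x : R) : nu [set x] = 0%E.
Proof.
have dom : nu `<< mu := normal_prob_dominates 0 1.
by move/null_content_dominatesP: dom; apply => //; exact: lebesgue_measure_set1.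
Qed.

Lemma normal_prob_gt0 : (0 < nu [set x : R | (0 < x)%R])%E.
Proof.
pose c : R := normal_pdf 0 1 1.
have c0 : 0 < c.
  by rewrite /c normal_pdfE ?oner_eq0// mulr_gt0 ?normal_peak_gt0 ?oner_eq0//
    expR_gt0.
have s01 : `]0, 1]%classic `<=` [set x : R | (0 < x)%R].
  by move=> x /=; rewrite in_itv /= => /andP[].
apply: (@lt_le_trans _ _ (nu `]0, 1]%classic)); last first.
  apply: le_measure => //; rewrite inE//.
  by rewrite -set_itvoy; exact: measurable_itv.
apply: (@lt_le_trans _ _ (\int[mu]_(x in `]0%R, 1%R]) c%:E)%E).
  rewrite integral_cst//= lebesgue_measure_itv /= lte01 oppr0 adde0 mule1.
  by rewrite lte_fin.
apply: ge0_le_integral => //=.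
- by move=> x _; rewrite lee_fin ltW.
- by apply: measurable_funTS; apply/measurable_EFinP; exact: measurable_normal_pdf.
move=> x; rewrite in_itv /= => /andP[x0 x1].
rewrite lee_fin /c !normal_pdfE ?oner_eq0// ler_wpM2l ?normal_peak_ge0//.
rewrite ler_expR !subr0 expr1n ler_pM2r ?invr_gt0// lerN2.
by apply: exprn_ile1 => //; exact: ltW.
Qed.

(** The exponential weight is absorbed by passing to the Gaussian of standard deviation 2, whose
    density is integrable. *)
Lemma expR_normal_pdf_le (b x : R) : expR (2 * (`|x| + b)) * normal_pdf 0 1 x <=
  expR (3 + 2 * b) * normal_peak 1 / normal_peak 2 * normal_pdf 0 2 x.
Proof.
rewrite !normal_pdfE ?oner_eq0//.
have p2 : normal_peak 2 != 0 :> R by rewrite gt_eqF ?normal_peak_gt0.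
rewrite mulrA (mulrC (expR _) (normal_peak 1)) -[leLHS]mulrA.
rewrite [leRHS](_ : _ = normal_peak 1 * (expR (3 + 2 * b) * normal_fun 0 2 x)).
    rewrite ler_wpM2l ?normal_peak_ge0//.
  rewrite /normal_fun -!expRD ler_expR !subr0 expr1n.
  rewrite -[x ^+ 2]real_normK ?num_real//; set y := `|x|.
  (* The function 2y - 3y^2/8 has its maximum at y = 8/3, with value 8/3 < 3. *)
  have := sqr_ge0 (y - 8 / 3); nra.
by field.
Qed.

Lemma normal_exp_moment (b : R) : (\int[nu]_x (expR (2 * (`|x| + b)))%:E < +oo)%E.
Proof.
have n2 : (2 : R) != 0 by [].
have mE : measurable_fun setT (fun x : R => (expR (2 * (`|x| + b)))%:E).
  apply/measurable_EFinP; apply: measurableT_comp => //.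
  by apply: measurable_funM => //; exact: measurable_funD.
rewrite ge0_integral_normal_prob//.
pose K : R := expR (3 + 2 * b) * normal_peak 1 / normal_peak 2.
have K0 : 0 <= K by rewrite divr_ge0 ?mulr_ge0 ?expR_ge0 ?normal_peak_ge0.
apply: (@le_lt_trans _ _ (\int[mu]_x (K%:E * (normal_pdf 0 2 x)%:E))%E).
  apply: ge0_le_integral => //.
  - by move=> x _; rewrite mule_ge0// lee_fin ?expR_ge0 ?normal_pdf_ge0.
  - apply: emeasurable_funM => //.
    by apply/measurable_EFinP; exact: measurable_normal_pdf.
  - by apply: measurable_funeM; apply/measurable_EFinP; exact: measurable_normal_pdf.
  by move=> x _; rewrite -!EFinM lee_fin; exact: expR_normal_pdf_le.
rewrite ge0_integralZl//.
- by rewrite integral_normal_pdf mule1 ltry.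
- by apply/measurable_EFinP; exact: measurable_normal_pdf.
- by move=> x _; rewrite lee_fin normal_pdf_ge0.
Qed.

Lemma integral_nu_cst (c : R) : (\int[nu]_x c%:E = c%:E)%E.
Proof.
transitivity (c%:E * nu setT)%E; first exact: integral_cst.
by rewrite (probability_setT nu) mule1.
Qed.

(** The 2 in the exponent absorbs the square that multiplies exp |y| in the second-order bound. *)
Definition exp_moment (b : R) : R := fine (\int[nu]_x (expR (2 * (`|x| + b)))%:E).

Lemma exp_momentE (b : R) :
  (\int[nu]_x (expR (2 * (`|x| + b)))%:E)%E = (exp_moment b)%:E.
Proof.
rewrite fineK// ge0_fin_numE ?normal_exp_moment//.
by apply: integral_ge0 => x _; rewrite lee_fin expR_ge0.
Qed.

Lemma le_exp_moment_integrable (b : R) (f : R -> R) :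
  measurable_fun setT f -> (forall x, `|f x| <= expR (2 * (`|x| + b))) ->
  nu.-integrable setT (EFin \o f).
Proof.
move=> mf fle; apply/integrableP; split; first exact/measurable_EFinP.
apply: le_lt_trans (normal_exp_moment b).
apply: ge0_le_integral => //=.
- by apply/measurable_EFinP; exact: measurableT_comp.
- apply/measurable_EFinP; apply: measurableT_comp => //.
  by apply: measurable_funM => //; exact: measurable_funD.
- by move=> x _; rewrite lee_fin.
Qed.

Lemma le_expR2 (y : R) : 0 <= y -> y <= expR (2 * y).
Proof. by move=> y0; apply: le_trans (expR_ge1Dx _); lra. Qed.

(** Integrate the second-order bound: the constant gives 1, the linear term vanishes by centering,
    and 1 + u <= exp u turns the rest into an exponential. *)
Lemma centered_mgf_le (b : R) (f : R -> R) (s : R) :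
  measurable_fun setT f -> (forall x, `|f x| <= `|x| + b) ->
  (\int[nu]_x (f x)%:E = 0)%E -> 0 <= s <= 1 ->
  (\int[nu]_x (expR (s * f x))%:E <=
    (expR (s ^+ 2 * (16 * exp_moment b)))%:E)%E.
Proof.
move=> mf fb f0 s01.
pose e (x : R) : R := expR (2 * (`|x| + b)).
have me : measurable_fun setT e.
  apply: measurableT_comp => //.
  by apply: measurable_funM => //; exact: measurable_funD.
have fi : nu.-integrable setT (EFin \o f).
  apply: (@le_exp_moment_integrable b) => // x.
  by apply: le_trans (fb x) (le_expR2 _); exact: le_trans (fb x).
have ei : nu.-integrable setT (EFin \o e).
  by apply: (@le_exp_moment_integrable b) => // x; rewrite ger0_norm ?expR_ge0.
pose g (x : R) : R := 1 + s * f x + s ^+ 2 * (16 * e x).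
apply: (@le_trans _ _ (\int[nu]_x (g x)%:E)%E).
  apply: ge0_le_integral => //=.
  - apply/measurable_EFinP; apply: measurableT_comp => //.
    exact: measurable_funM.
  - apply/measurable_EFinP; apply: measurable_funD.
      by apply: measurable_funD => //; exact: measurable_funM.
    by apply: measurable_funM => //; exact: measurable_funM.
  - move=> x _; rewrite lee_fin.
    apply: le_trans (@expR_le_quadratic s (f x) s01) _.
    by rewrite /g lerD2l ler_wpM2l ?sqr_ge0// ler_wpM2l// ler_expR ler_wpM2l.
rewrite /g.
under eq_integral do rewrite !EFinD !EFinM.
rewrite integralD//=; last 2 first.
- apply: integrableD => //; first exact: finite_measure_integrable_cst.
  exact: integrableZl.
- by apply: integrableZl => //; exact: integrableZl.
rewrite integralD//=; last 2 first.
- exact: finite_measure_integrable_cst.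
- exact: integrableZl.
rewrite integralZl// f0 mule0 adde0 integral_nu_cst integralZl//; last exact: integrableZl.
rewrite integralZl// exp_momentE -!EFinM -EFinD lee_fin.
exact: expR_ge1Dx.
Qed.

Definition relu_mean : R := fine (\int[nu]_x (Num.max x 0)%:E).
(** The expected share of planted entries on which truncation loses nothing of the signal: max(mu +
    w, 0) = mu + max(w, 0) when w > 0. *)
Definition pos_mass : R := fine (nu [set x : R | (0 < x)%R]).

Lemma measurable_relu : measurable_fun setT (fun x : R => Num.max x 0).
Proof. exact: measurable_maxr. Qed.

Lemma measurable_pos : measurable [set x : R | (0 < x)%R].
Proof. by rewrite -set_itvoy; exact: measurable_itv. Qed.

Lemma pos_mass_gt0 : 0 < pos_mass.
Proof. by rewrite fine_gt0// normal_prob_gt0 ltey_eq fin_num_measure//; exact: measurable_pos. Qed.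

Lemma relu_le (x : R) : `|Num.max x 0| <= `|x|.
Proof. by rewrite /Order.max; case: ifP; rewrite ?normr0. Qed.

Lemma relu_integrable : nu.-integrable setT (fun x : R => (Num.max x 0)%:E).
Proof.
apply: (@le_exp_moment_integrable 0) => [|x]; first exact: measurable_relu.
by rewrite addr0; apply: le_trans (relu_le x) (le_expR2 _).
Qed.

Lemma integral_relu : (\int[nu]_x (Num.max x 0)%:E)%E = relu_mean%:E.
Proof. by rewrite fineK//; exact: integrable_fin_num relu_integrable. Qed.

Lemma relu_mean_ge0 : 0 <= relu_mean.
Proof.
rewrite fine_ge0//; apply: integral_ge0 => x _.
by rewrite lee_fin le_max lexx orbT.
Qed.

Lemma integral_relu_centered : (\int[nu]_x (Num.max x 0 - relu_mean)%:E = 0)%E.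
Proof.
under eq_integral do rewrite EFinB.
rewrite integralB//=; [|exact: relu_integrable|exact: finite_measure_integrable_cst].
by rewrite integral_relu integral_nu_cst subee.
Qed.

Lemma integral_pos_centered :
  (\int[nu]_x (pos_mass - (0 < x)%R%:R)%R%:E = 0)%E.
Proof.
have E (x : R) : (0 < x)%R%:R = \1_[set y : R | (0 < y)%R] x :> R.
  by rewrite indicE; congr (_%:R); rewrite mem_setE.
under eq_integral do rewrite E EFinB.
rewrite integralB//=; last 2 first.
- exact: finite_measure_integrable_cst.
- by apply: integrable_indic => //; exact: measurable_pos.
rewrite integral_nu_cst integral_indic//; last exact: measurable_pos.
rewrite setIT /pos_mass fineK ?subee// ?fin_num_measure//; exact: measurable_pos.
Qed.

End Gaussian.

(** * Combinatorics of peeling: states, runs and scores *)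

Section Peeling.
Context (n : nat).
Implicit Types (p v s : binvec n) (i l : 'I_n).

Definition included p s := forall i, p i -> s i.

Definition remove l p : binvec n := [ffun i => if i == l then false else p i].

Lemma removeE l p i : remove l p i = (i != l) && p i.
Proof. by rewrite ffunE; case: eqP. Qed.

Lemma included_anti p s : included p s -> included s p -> p = s.
Proof. by move=> ps sp; apply/ffunP => i; apply/idP/idP; [exact: ps|exact: sp]. Qed.

Lemma included_l0norm p s : included p s -> (l0norm p <= l0norm s)%N.
Proof.
by move=> ps; apply/subset_leq_card/fintype.subsetP => i; rewrite !inE; exact: ps.
Qed.

Lemma included_eq p s : included p s -> (l0norm s <= l0norm p)%N -> p = s.
Proof.
move=> ps sp; apply: (included_anti ps) => i si.
have /eqP E : [set j | p j]%SET == [set j | s j]%SET.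
  rewrite eqEcard sp andbT.
  by apply/fintype.subsetP => j; rewrite !inE; exact: ps.
have : i \in [set j | s j]%SET by rewrite inE.
by rewrite -E inE.
Qed.

Lemma l0norm_remove l p : p l -> (l0norm (remove l p)).+1 = l0norm p.
Proof.
move=> pl; rewrite /l0norm (cardsD1 l [set i | p i]%SET) inE pl add1n.
by congr (_.+1); apply: eq_card => i; rewrite !inE removeE.
Qed.

Lemma l0norm_full : l0norm ([ffun=> true] : binvec n) = n.
Proof.
rewrite /l0norm -[RHS]card_ord; apply: eq_card => i.
by rewrite !inE ffunE.
Qed.

Lemma l0norm_le p : (l0norm p <= n)%N.
Proof. by rewrite /l0norm -[X in (_ <= X)%N]card_ord max_card. Qed.

(** A relation, since ties may be broken in several ways; the recursive form supports induction on
    the number of steps. *)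
Fixpoint reach (step : binvec n -> binvec n -> Prop) t p : Prop :=
  if t is t'.+1 then exists2 s, reach step t' s & step s p
  else p = [ffun=> true].

Lemma reachP (step : binvec n -> binvec n -> Prop) t p :
  reach step t p <-> exists f : nat -> binvec n,
    [/\ f 0%N = [ffun=> true], forall j, (j < t)%N -> step (f j) (f j.+1)
      & p = f t].
Proof.
split.
  elim: t p => [p ->|t IH p /= [s /IH [f [f0 fS ->]] sp]].
    by exists (fun=> [ffun=> true]).
  exists (fun j => if (j <= t)%N then f j else p); split => //.
    move=> j; rewrite ltnS => jt; rewrite jt.
    have [jt'|tj] := ltnP j t; first exact: fS.
    by rewrite (_ : j = t)//; apply/eqP; rewrite eqn_leq jt.
  by rewrite ltnn.
move=> [f [f0 fS ->]]; elim: t fS => [//|t IH fS] /=.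
exists (f t); last exact: fS.
by apply: IH => j jt; apply: fS; exact: ltnW.
Qed.

Definition removing (step : binvec n -> binvec n -> Prop) :=
  forall p s, step p s -> exists2 l, p l & s = remove l p.

Lemma reach_l0norm step t p : removing step -> reach step t p ->
  (l0norm p + t = n)%N.
Proof.
move=> rs; elim: t p => [p ->|t IH p /= [s /IH sn /rs [l sl ->]]].
  by rewrite addn0 l0norm_full.
by rewrite addnS -addSn l0norm_remove.
Qed.

Context (R : realType) (q : nat).
Notation tuples := (q.+1.-tuple 'I_n).

(** The support of the tensor [unit_tpow] of [l] and [p]. Throughout, [q] is r - 1. *)
Definition rowset l p : {set tuples} :=
  [set t | [forall j : 'I_q.+1,
    if nat_of_ord j == 0%N then tnth t j == l else p (tnth t j)]]%SET.

(** The disjoint union of the sets [rowset i p] over the [i] in [p] outside [v]. *)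
Definition outer_rows v p : {set tuples} :=
  [set t | [forall j : 'I_q.+1,
    p (tnth t j) && ((nat_of_ord j == 0%N) ==> ~~ v (tnth t j))]]%SET.

Definition score (Q : tuples -> R) l p : R := \sum_(t in rowset l p) Q t.

Lemma rowset_head l p t : t \in rowset l p -> tnth t ord0 = l.
Proof. by rewrite inE => /forallP /(_ ord0) /eqP. Qed.

Lemma rowset_sub l p s : included p s -> rowset l p \subset rowset l s.
Proof.
move=> ps; apply/fintype.subsetP => t; rewrite !inE => /forallP H.
by apply/forallP => j; move: (H j); case: ifP => // _; exact: ps.
Qed.

Lemma dott_unit_tpow l p (Q : tensor R q.+1 n) :
  dott (unit_tpow q.+1 l (vec R p)) Q = score Q l p.
Proof.
rewrite /dott /score [RHS]big_mkcond; apply: eq_bigr => t _.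
rewrite ffunE inE; case: ifPn => [/forallP H|/forallPn [j Hj]].
  rewrite big1 ?mul1r// => j _; move: (H j); case: ifP => _ h; rewrite mxE.
    by rewrite (eqP h) !eqxx.
  by rewrite h.
rewrite (bigD1 j)//=; move: Hj; case: ifP => _ h; rewrite mxE.
  by rewrite (negbTE h) andbF !mul0r.
by rewrite (negbTE h) !mul0r.
Qed.

Lemma card_tuple_family (F : 'I_q.+1 -> pred 'I_n) :
  #|[set t : tuples | [forall j, F j (tnth t j)]]%SET| = (\prod_j #|F j|)%N.
Proof.
transitivity #|family F|.
  rewrite -(card_imset _ (can_inj (@finfun_of_tupleK _ _))).
  apply: eq_card => f; apply/imsetP/familyP => [[t + ->] j|Ff].
    by rewrite inE => /forallP /(_ j); rewrite ffunE.
  exists (tuple_of_finfun f); rewrite ?tuple_of_finfunK// inE.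
  by apply/forallP => j; rewrite tnth_mktuple; exact: Ff.
by rewrite card_family foldrE big_map big_enum.
Qed.

Lemma card_rowset l p : #|rowset l p| = (l0norm p ^ q)%N.
Proof.
pose F (j : 'I_q.+1) i := if nat_of_ord j == 0%N then i == l else p i.
rewrite (card_tuple_family F) big_ord_recl /=.
rewrite (_ : #|F ord0| = 1%N); last by rewrite -(card1 l); apply: eq_card => i.
rewrite mul1n (eq_bigr (fun=> l0norm p)) ?prod_nat_const ?card_ord// => j _.
by rewrite /l0norm; apply: eq_card => i; rewrite !inE.
Qed.

Lemma card_outer_rows v p : included v p ->
  #|outer_rows v p| = ((l0norm p - l0norm v) * l0norm p ^ q)%N.
Proof.
move=> vp.
pose F (j : 'I_q.+1) i := p i && ((nat_of_ord j == 0%N) ==> ~~ v i).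
rewrite (card_tuple_family F) big_ord_recl /=; congr (_ * _)%N.
  rewrite /l0norm -(cardsDS (A := [set i | p i]%SET)); last first.
    by apply/fintype.subsetP => i; rewrite !inE; exact: vp.
  by apply: eq_card => i; rewrite !inE /F /= andbC.
rewrite (eq_bigr (fun=> l0norm p)) ?prod_nat_const ?card_ord// => j _.
by rewrite /l0norm; apply: eq_card => i; rewrite !inE unfold_in /F /= andbT.
Qed.

Lemma sum_outer_rows (Q : tuples -> R) v p :
  \sum_(t in outer_rows v p) Q t = \sum_(i | p i && ~~ v i) score Q i p.
Proof.
rewrite (partition_big (fun t => tnth t ord0) (fun i => p i && ~~ v i)) /=.
  apply: eq_bigr => i /andP[pi vi]; apply: eq_bigl => t.
  rewrite !inE; apply/andP/forallP => [[/forallP H /eqP ti] j|H].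
    have := H j; case: ifPn => [/eqP j0 _|j0 /andP[]//].
    by rewrite -ti; apply/eqP; congr tnth; exact: val_inj.
  split; last exact: (H ord0).
  apply/forallP => j; have := H j; case: ifPn => [_ /eqP ->|_ ->//].
  by rewrite pi vi.
by move=> t; rewrite inE => /forallP /(_ ord0).
Qed.

Lemma score_mono (Q : tuples -> R) l p s : (forall t, 0 <= Q t) ->
  included p s -> score Q l p <= score Q l s.
Proof.
move=> Q0 ps; rewrite /score [leRHS](big_setID (rowset l p)) /=.
rewrite (finset.setIidPr (rowset_sub l ps)) lerDl; exact: sumr_ge0.
Qed.

(** * The ghost run and its insensitivity to ties at zero *)

Section Ghost.
Context (v : binvec n) (Q : tuples -> R).

(* The scores compared here only involve rows of indices outside v. *)
Definition ghost_step p s := exists l,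
  [/\ p l, ~~ v l, forall i, p i -> ~~ v i -> score Q l p <= score Q i p
    & s = remove l p].

Definition positive_scores p := forall i, p i -> ~~ v i -> 0 < score Q i p.

(** Restricted to positive scores: truncation makes scores vanish, and hence tie, with positive
    probability. *)
Definition no_tie := forall p i l, p i -> p l -> ~~ v i -> ~~ v l -> i != l ->
  0 < score Q i p -> score Q i p != score Q l p.

Lemma ghost_step_removing : removing ghost_step.
Proof. by move=> p s [l [pl _ _ ->]]; exists l. Qed.

Hypothesis Q0 : forall t, 0 <= Q t.
Hypothesis notie : no_tie.

(** In the second case [p'] is the state at the first removal of an element of [s]: it still
    contains [s], and all later states lie inside [remove l p']. *)
Lemma ghost_history t p s : reach ghost_step t p ->
  included s p \/ exists u p' l, [/\ reach ghost_step u p',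
    [/\ p' l, ~~ v l & forall i, p' i -> ~~ v i -> score Q l p' <= score Q i p'],
    included s p', s l & included p (remove l p')].
Proof.
elim: t p => [p -> |t IH p /= [p' rp' [l [pl vl lmin ->]]]].
  by left => i _; rewrite ffunE.
have [sp'|[u [p2 [l2 [r2 m2 sp2 sl2 p'p2]]]]] := IH _ rp'.
  have [sl|sl] := boolP (s l).
    by right; exists t, p', l; split.
  left => i si; rewrite removeE sp'// andbT.
  by apply: contraNneq sl => <-.
right; exists u, p2, l2; split => // i; rewrite removeE => /andP[_].
exact: p'p2.
Qed.

(* The culprit l would make s positive as well; in the run leading to p, the
   first index that s has kept is then a culprit for a larger pair of states,
   unless it ties with l. *)
Lemma ghost_keep m t p u s l : (n - l0norm s < m)%N ->
  reach ghost_step t p -> positive_scores p -> reach ghost_step u s ->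
  included p s -> p != s -> s l -> ~~ v l ->
  (forall i, s i -> ~~ v i -> score Q l s <= score Q i s) -> ~~ p l.
Proof.
elim: m t p u s l => [//|m IH] t p u s l nm rp pp rs ps npq sl vl lmin.
apply/negP => pl.
have ps_pos : positive_scores s.
  move=> i si vi; apply: lt_le_trans (lmin i si vi).
  exact: lt_le_trans (pp l pl vl) (score_mono l Q0 ps).
have [sp|[w [p' [l' [rp' [p'l' vl' l'min] sp' sl' pp']]]]] :=
    ghost_history s rp.
  by move: npq; rewrite (included_anti ps sp) eqxx.
(* If [s] is [p'] itself, then [l] and [l'] both minimise its positive scores. They differ because
   [p] contains [l] but has lost [l'], so this is a forbidden tie. *)
have [sE|sNp'] := eqVneq s p'.
  have ll' : l != l'.
    by apply: contraTneq pl => ->; apply/negP => /pp'; rewrite removeE eqxx.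
  move: (notie sl sl' vl vl' ll' (ps_pos l sl vl)).
  by rewrite eq_le lmin//= sE l'min// -sE.
suff : ~~ s l' by rewrite sl'.
apply: (IH u s w p' l') => //.
(* [s] is strictly inside [p'], so the induction measure decreases. *)
move: nm; rewrite ltnS => nm; apply: leq_trans nm; rewrite ltn_sub2l//.
  rewrite ltnNge; apply/negP => ns.
  move: sNp'; rewrite (included_eq sp') ?eqxx//; apply: leq_trans ns.
  rewrite -[n in (_ <= n)%N]l0norm_full; apply: included_l0norm => i _.
  by rewrite ffunE.
rewrite ltnNge; apply/negP => ns.
by move: sNp'; rewrite (included_eq sp') ?eqxx.
Qed.

(** Along the run to [s], as long as the state strictly contains [p], the removed index lies outside
    [p] by [ghost_keep]. Once the state equals [p], later states are subsets of it. *)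
Lemma ghost_comparable t p u s : reach ghost_step t p -> positive_scores p ->
  reach ghost_step u s -> included p s \/ included s p.
Proof.
move=> rp pp; elim: u s => [s ->|u IH s /= [p' rp' [l [pl vl lmin ->]]]].
  by left => i _; rewrite ffunE.
have [pp'|p'p] := IH _ rp'; last first.
  by right => i; rewrite removeE => /andP[_]; exact: p'p.
have [->|ne] := eqVneq p p'; first by right => i; rewrite removeE => /andP[].
have npl := ghost_keep (ltnSn _) rp pp rp' pp' ne pl vl lmin.
left => i pi; rewrite removeE pp'// andbT.
by apply: contraNneq npl => <-.
Qed.

(** Comparable states after equally many steps have the same size, hence coincide. This is what
    reduces the later union bound to one state per size. *)
Lemma ghost_reach_unique t p s : reach ghost_step t p -> positive_scores p ->
  reach ghost_step t s -> p = s.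
Proof.
move=> rp pp rs.
have E : l0norm p = l0norm s.
  apply: (@addIn t); rewrite (reach_l0norm ghost_step_removing rp).
  by rewrite (reach_l0norm ghost_step_removing rs).
have [ps|sp] := ghost_comparable rp pp rs; first by apply: included_eq; rewrite ?E.
by apply/esym; apply: included_eq; rewrite ?E.
Qed.

End Ghost.

(** * Deterministic analysis: the algorithm follows the ghost run *)

Section Planted.
Context (v : binvec n) (k : nat) (mu : R) (W : tensor R q.+1 n).
Notation relu := (fun t => Num.max (W t) 0).
Let Y : tensor R q.+1 n := [ffun t => mu * tpow q.+1 (vec R v) t + W t].
Notation Q := (pos_part Y).

Lemma tpow_vecE t : tpow q.+1 (vec R v) t = [forall j, v (tnth t j)]%:R.
Proof.
rewrite ffunE; have [/forallP H|/forallPn [j Hj]] := boolP [forall j, v (tnth t j)].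
  by rewrite big1// => j _; rewrite mxE H.
by rewrite (bigD1 j)//= mxE (negbTE Hj) mul0r.
Qed.

(** A tuple whose first index is outside [v] carries no signal. *)
Lemma score_nonplanted i p : ~~ v i -> score Q i p = score relu i p.
Proof.
move=> vi; apply: eq_bigr => t /rowset_head ti; rewrite 2!ffunE tpow_vecE.
rewrite (_ : [forall j, _] = false) ?mulr0 ?add0r//.
by apply/negbTE/forallPn; exists ord0; rewrite ti.
Qed.

(** Entrywise: a nonnegative signal never lowers the truncated entry, and it adds in full where the
    entry is planted and its noise is positive. *)
Lemma score_planted l p : 0 <= mu -> v l -> included v p ->
  score relu l p + mu * \sum_(t in rowset l v) (0 < W t)%R%:R <= score Q l p.
Proof.
move=> mu0 vl vp.
have E : \sum_(t in rowset l v) (0 < W t)%R%:R =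
    \sum_(t in rowset l p) (if t \in rowset l v then (0 < W t)%R%:R else 0) :> R.
  rewrite -big_mkcondr; apply: eq_bigl => t; apply/idP/andP => [tv|[]//].
  by split=> //; exact: (fintype.subsetP (rowset_sub l vp)).
rewrite E mulr_sumr -big_split /=; apply: ler_sum => t tp.
rewrite 2!ffunE tpow_vecE.
case: ifPn => [tv|_]; last first.
  rewrite mulr0 addr0 ge_max !le_max lexx orbT andbT.
  by rewrite lerDr mulr_ge0.
have -> : [forall j, v (tnth t j)].
  apply/forallP => j; move: tv; rewrite inE => /forallP /(_ j).
  by case: ifP => // _ /eqP ->.
rewrite mulr1; have [W0|W0] := ltP 0 (W t).
  by rewrite mulr1 addrC le_max lexx.
by rewrite mulr0 addr0 le_max lexx orbT.
Qed.

(** [c0] and [p0] stand for the mean truncated noise and the probability of positive noise. The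
    allowed deviations are [a1] for the average non-planted row, [a2] for the count of positive
    planted entries, and [a3] for a single planted row. *)
Variables (c0 p0 a1 a2 a3 : R).
Hypothesis vk : l0norm v = k.
Hypothesis mu0 : 0 < mu.
Hypothesis a13 : 0 <= a1 + a3.
Hypothesis outer_small : forall p, included v p -> (3 * k < 2 * l0norm p)%N ->
  \sum_(t in outer_rows v p) (relu t - c0) <= a1 * (l0norm p - k)%:R.
Hypothesis planted_positive : forall l, v l ->
  \sum_(t in rowset l v) (p0 - (0 < W t)%R%:R) <= a2.
Hypothesis planted_large : forall t p l, reach (ghost_step v relu) t p ->
  positive_scores v relu p -> v l ->
  \sum_(t in rowset l p) (c0 - relu t) <= a3.
Hypothesis signal : a1 + a3 < mu * (p0 * (k ^ q)%:R - a2).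

Lemma planted_count l : v l ->
  p0 * (k ^ q)%:R - a2 <= \sum_(t in rowset l v) (0 < W t)%R%:R.
Proof.
move=> vl; have := planted_positive vl.
rewrite sumrB sumr_const card_rowset vk -mulr_natr; lra.
Qed.

(** If a planted index were a minimiser, every non-planted score would be at least as large, and so
    would their average. That average exceeds its mean by at most [a1], while the signal lifts the
    planted score further. *)
Lemma peeling_keeps_planted t p : (t <= n - (3 * k) %/ 2)%N ->
  reach (peel_step (pos_part Y)) t p ->
  included v p /\ reach (ghost_step v relu) t p.
Proof.
have signal0 : 0 < mu * (p0 * (k ^ q)%:R - a2) by exact: le_lt_trans signal.
elim: t p => [p _ -> |t IH p tN /= [s rs [l [sl lmin ->]]]].
  by split=> // i _; rewrite ffunE.
have [vs gs] := IH s (ltnW tN) rs.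
have sizes : (l0norm s + t = n)%N.
  by apply: reach_l0norm gs; exact: ghost_step_removing.
(* Before each step the size is at least floor(3k/2) + 1, which exceeds 3k/2 for odd [k] as well. *)
have large : (3 * k < 2 * l0norm s)%N.
  by have := divn_eq (3 * k) 2; have := ltn_pmod (3 * k) (isT : 0 < 2)%N; lia.
have {}lmin i : s i -> score Q l s <= score Q i s.
  by move=> /lmin; rewrite !dott_unit_tpow.
have vl : ~~ v l.
  apply/negP => vl.
  have pl := score_planted (ltW mu0) vl vs.
  have cl : mu * (p0 * (k ^ q)%:R - a2) <=
      mu * \sum_(t in rowset l v) (0 < W t)%R%:R.
    by rewrite ler_wpM2l ?planted_count// ltW.
  have sl0 : 0 <= score relu l s.
    by apply: sumr_ge0 => u _; rewrite le_max lexx orbT.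
  (* The minimum is attained at [l] and is positive thanks to the signal, so all non-planted scores
     are positive and [planted_large] applies to [s]. *)
  have pos : positive_scores v relu s.
    move=> i si vi; rewrite -score_nonplanted//.
    apply: lt_le_trans (lmin i si); apply: lt_le_trans pl; lra.
  have big := planted_large gs pos vl.
  have := outer_small vs large; rewrite sum_outer_rows.
  set M := l0norm s in large *.
  have kM : (k < M)%N by clear -large; lia.
  have card_outer : (\sum_(i | s i && ~~ v i) 1 = M - k)%N.
    rewrite sum1_card -vk -cardsDS; last first.
      by apply/fintype.subsetP => i; rewrite !inE; exact: vs.
    by apply: eq_card => i; rewrite !inE andbC.
  (* The excess of the planted score over its noise mean; by minimality of [l] it bounds from below
     the excess of each of the [M - k] non-planted rows. *)
  pose c := score Q l s - c0 * (M ^ q)%:R.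
  have row_sum i (F : tuples -> R) :
      \sum_(t in rowset i s) (F t - c0) = score F i s - c0 * (M ^ q)%:R.
    by rewrite /score /M sumrB sumr_const card_rowset mulr_natr.
  have lower : c * (M - k)%:R <=
      \sum_(i | s i && ~~ v i) score (fun t => relu t - c0) i s.
    rewrite -card_outer natr_sum mulr_sumr; apply: ler_sum => i /andP[si vi].
    by rewrite mulr1 /score row_sum /c -score_nonplanted// lerD2r lmin.
  move=> upper; have := le_trans lower upper.
  rewrite ler_pM2r ?ltr0n ?subn_gt0// => ca1.
  move: big; rewrite sumrB sumr_const card_rowset -/M -mulr_natr.
  rewrite -/(score relu l s) => big.
  move: pl (lt_le_trans signal cl) big ca1; rewrite /c.
  move: (mu * _) (score _ l s) (score Q l s) (c0 * _) => S A B K.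
  by lra.
split.
  by move=> i vi; rewrite removeE vs// andbT; apply: contraNneq vl => <-.
(* Observed and pure-noise scores coincide on non-planted rows, so the peeling step is also a ghost
   step. *)
exists s => //; exists l; split => // i si vi.
by rewrite -!score_nonplanted// lmin.
Qed.

Lemma peeling_output_contains s : peeling_output k Y s ->
  included v s /\ (l0norm s + (n - (3 * k) %/ 2) = n)%N.
Proof.
move=> /reachP rs; have [vs gs] := peeling_keeps_planted (leqnn _) rs.
split=> //; apply: reach_l0norm gs; exact: ghost_step_removing.
Qed.

End Planted.
End Peeling.

(** * Measurability of events about runs *)

Section Finite_events.
Context d (T : measurableType d).

Lemma measurable_forall (F : finType) (E : F -> T -> Prop) :
  (forall i, measurable [set w | E i w]) -> measurable [set w | forall i, E i w].
Proof.
move=> mE; rewrite (_ : [set w | _] = \bigcap_(i in setT) [set w | E i w]).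
  exact: fin_bigcap_measurable.
by apply/seteqP; split=> w /= H i; [move=> _; exact: H|exact: (H i I)].
Qed.

Lemma measurable_exists (F : finType) (E : F -> T -> Prop) :
  (forall i, measurable [set w | E i w]) -> measurable [set w | exists i, E i w].
Proof.
move=> mE; rewrite (_ : [set w | _] = \bigcup_(i in setT) [set w | E i w]).
  exact: fin_bigcup_measurable.
by apply/seteqP; split=> w /= [i]; [exists i|move=> _; exists i].
Qed.

Lemma measurable_imply_cst (Q : Prop) (E : T -> Prop) :
  (Q -> measurable [set w | E w]) -> measurable [set w | Q -> E w].
Proof.
move=> mE; have [q|nq] := pselect Q.
  rewrite (_ : [set w | _] = [set w | E w]); first exact: mE.
  by apply/seteqP; split=> w /=; [exact|].
by rewrite (_ : [set w | _] = setT)//; apply/seteqP; split=> w //= _ /nq.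
Qed.

Lemma measurable_and_cst (Q : Prop) (E : T -> Prop) :
  (Q -> measurable [set w | E w]) -> measurable [set w | Q /\ E w].
Proof.
move=> mE; have [q|nq] := pselect Q.
  rewrite (_ : [set w | _] = [set w | E w]); first exact: mE.
  by apply/seteqP; split=> w /= => [[]|].
by rewrite (_ : [set w | _] = set0)//; apply/seteqP; split=> w // [].
Qed.

Lemma measurable_andP (E F : T -> Prop) : measurable [set w | E w] ->
  measurable [set w | F w] -> measurable [set w | E w /\ F w].
Proof. by move=> mE mF; exact: measurableI. Qed.

Lemma measurable_cstP (Q : Prop) : measurable [set w : T | Q].
Proof.
have [q|nq] := pselect Q.
  by rewrite (_ : [set w | _] = setT)//; apply/seteqP; split.
by rewrite (_ : [set w | _] = set0)//; apply/seteqP; split.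
Qed.

Context (R : realType).
Implicit Types f g : T -> R.

Lemma measurable_boolP (b : T -> bool) : measurable_fun setT b ->
  measurable [set w | b w].
Proof.
move=> mb; rewrite (_ : [set w | _] = setT `&` b @^-1` [set true]).
  exact: mb.
by rewrite setTI; apply/seteqP; split.
Qed.

Lemma measurable_leP f g : measurable_fun setT f -> measurable_fun setT g ->
  measurable [set w | f w <= g w].
Proof. by move=> mf mg; apply: measurable_boolP; exact: measurable_fun_ler. Qed.

Lemma measurable_ltP f g : measurable_fun setT f -> measurable_fun setT g ->
  measurable [set w | f w < g w].
Proof. by move=> mf mg; apply: measurable_boolP; exact: measurable_fun_ltr. Qed.

Lemma measurable_neqP f g : measurable_fun setT f -> measurable_fun setT g ->
  measurable [set w | f w != g w].
Proof.
move=> mf mg; apply: measurable_boolP.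
by apply: measurable_neg; exact: measurable_fun_eqr.
Qed.

Lemma measurable_reach n (step : T -> binvec n -> binvec n -> Prop) t p :
  (forall p s, measurable [set w | step w p s]) ->
  measurable [set w | reach (step w) t p].
Proof.
move=> mS; elim: t p => [p|t IH p] /=; first exact: measurable_cstP.
rewrite (_ : [set w | _] = [set w | exists s, reach (step w) t s /\ step w s p]).
  by apply: measurable_exists => s; exact: measurable_andP.
by apply/seteqP; split=> w [s]; [move=> ? ?; exists s|move=> []; exists s].
Qed.

Context (n q : nat).
Notation tuples := (q.+1.-tuple 'I_n).

Lemma measurable_score (Q : T -> tuples -> R) l (p : binvec n) :
  (forall t, t \in rowset q l p -> measurable_fun setT (Q ^~ t)) ->
  measurable_fun setT (fun w => score (Q w) l p).
Proof.
move=> mQ; rewrite /score.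
under eq_fun do rewrite big_mkcond.
apply: measurable_sum => t; have [tp|_ //] := boolP (t \in rowset q l p).
exact: mQ.
Qed.

Lemma measurable_peel_step (Q : T -> tensor R q.+1 n) (p s : binvec n) :
  (forall t, measurable_fun setT (fun w => Q w t)) ->
  measurable [set w | peel_step (Q w) p s].
Proof.
move=> mQ; apply: measurable_exists => l.
rewrite (_ : [set w | _] = [set w | (p l /\ s = remove l p) /\ forall i, p i ->
    score (Q w) l p <= score (Q w) i p]); last first.
  apply/seteqP; split=> w /=.
    by move=> [pl lmin sl]; split=> // i /lmin; rewrite !dott_unit_tpow.
  move=> [[pl sl] lmin]; split=> // i /lmin.
  by rewrite !dott_unit_tpow.
apply: measurable_and_cst => _; apply: measurable_forall => i.
apply: measurable_imply_cst => _.
by apply: measurable_leP; apply: measurable_score.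
Qed.

Section Ghost.
Variables (v : binvec n) (Q : T -> tuples -> R).
Hypothesis mQ : forall t, ~~ v (tnth t ord0) -> measurable_fun setT (Q ^~ t).

Lemma measurable_score_nonplanted i (p : binvec n) : ~~ v i ->
  measurable_fun setT (fun w => score (Q w) i p).
Proof.
move=> vi; apply: measurable_score => t /rowset_head ti.
by apply: mQ; rewrite ti.
Qed.

Lemma measurable_ghost_step (p s : binvec n) :
  measurable [set w | ghost_step v (Q w) p s].
Proof.
apply: measurable_exists => l.
rewrite (_ : [set w | _] = [set w | [/\ p l, ~~ v l & s = remove l p] /\
    forall i, p i /\ ~~ v i -> score (Q w) l p <= score (Q w) i p]); last first.
  apply/seteqP; split=> w /=.
    by move=> [pl vl lmin sl]; split=> // i [pi vi]; exact: lmin.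
  by move=> [[pl vl sl] lmin]; split=> // i pi vi; exact: lmin.
apply: measurable_and_cst => -[pl vl _]; apply: measurable_forall => i.
apply: measurable_imply_cst => -[_ vi].
by apply: measurable_leP; exact: measurable_score_nonplanted.
Qed.

Lemma measurable_positive_scores (p : binvec n) :
  measurable [set w | positive_scores v (Q w) p].
Proof.
apply: measurable_forall => i; apply: measurable_imply_cst => _.
apply: measurable_imply_cst => vi.
by apply: measurable_ltP => //; exact: measurable_score_nonplanted.
Qed.

Lemma measurable_no_tie : measurable [set w | no_tie v (Q w)].
Proof.
apply: measurable_forall => p; apply: measurable_forall => i.
apply: measurable_forall => l.
do 2 (apply: measurable_imply_cst => _).
apply: measurable_imply_cst => vi; apply: measurable_imply_cst => vl.
apply: measurable_imply_cst => _.
rewrite (_ : [set w | _] = ~` [set w | 0 < score (Q w) i p] `|`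
  [set w | score (Q w) i p != score (Q w) l p]).
  apply: measurableU.
    apply: measurableC; apply: measurable_ltP => //.
    exact: measurable_score_nonplanted.
  by apply: measurable_neqP; exact: measurable_score_nonplanted.
apply/seteqP; split=> w /=.
  by move=> H; have [/H|] := boolP (0 < score (Q w) i p); [right|move=> /negP; left].
by move=> [H /H|].
Qed.

End Ghost.

End Finite_events.

(** * Union bounds over finite families of events *)

Section Union_bounds.
Context d (T : measurableType d) (R : realType) (P : probability T R).
Context (F : finType) (E : F -> set T).
Hypothesis mE : forall i, measurable (E i).

Lemma prob_exists_le : (P [set w | exists i, E i w] <= \sum_(i : F) P (E i))%E.
Proof.
rewrite (_ : [set w | _] = \bigcup_(i in [set` index_enum F]) E i).
  rewrite bigcup_seq; elim: (index_enum F) => [|i s IH].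
    by rewrite !big_nil measure0.
  rewrite !big_cons; apply: le_trans (measureU2 _ _ _) _ => //.
    by apply: bigsetU_measurable.
  by rewrite leeD2l.
apply/seteqP; split=> w /= [i]; last by move=> _; exists i.
by exists i => //=; rewrite mem_index_enum.
Qed.

Lemma prob_disjoint_le1 : (forall i j w, E i w -> E j w -> i = j) ->
  (\sum_(i : F) P (E i) <= 1)%E.
Proof.
move=> dE.
have tE : trivIset [set` index_enum F] E.
  by move=> i j _ _ [w [Ei Ej]]; exact: dE Ei Ej.
apply: le_trans (probability_le1 P (A := \bigcup_(i in [set` index_enum F]) E i) _).
  by rewrite measure_fin_bigcup// fsbig_seq ?index_enum_uniq.
exact: fin_bigcup_measurable.
Qed.

End Union_bounds.

(** * Chernoff bounds for centered functions of independent normal variables *)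

Section Normal_families.
Context d (T : measurableType d) (R : realType) (P : probability T R).
Notation relu_mean := (relu_mean R).
Notation pos_mass := (pos_mass R).

(** The envelope [|x| + (relu_mean + 1)] serves the truncated noise, its opposite and the indicator
    of positivity, so one constant covers all three. *)
Definition mgf_const : R := 16 * exp_moment (relu_mean + 1).

Lemma mgf_const_ge0 : 0 <= mgf_const.
Proof.
rewrite mulr_ge0// /exp_moment fine_ge0//; apply: integral_ge0 => x _.
by rewrite lee_fin expR_ge0.
Qed.

Lemma std_normal_integral (Y : {RV P >-> R}) (f : R -> R) : std_normal Y ->
  measurable_fun setT f -> (forall x, 0 <= f x) ->
  (\int[P]_w (f (Y w))%:E = \int[normal_prob 0%R 1%R]_x (f x)%:E)%E.
Proof.
move=> nY mf f0.
have mY : measurable_fun setT (Y : T -> measurableTypeR R).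
  by move=> _ B mB; exact: (measurable_funPT Y).
pose Y' : {mfun T >-> measurableTypeR R} :=
  @mfun_Sub _ _ T (measurableTypeR R) _ (mem_set mY).
transitivity (\int[distribution P Y']_x (f x)%:E)%E.
  by rewrite ge0_integral_distribution//=; exact/measurable_EFinP.
by apply: eq_measure_integral => A mA _; exact: nY.
Qed.

Lemma std_normal_atomless (Y : {RV P >-> R}) x : std_normal Y ->
  P (Y @^-1` [set x]) = 0%E.
Proof. by move=> nY; rewrite nY//; exact: normal_prob_set1. Qed.

Context (I : finType) (X : I -> {RV P >-> R}).
Hypothesis indX : mutually_independent X.
Hypothesis stdX : forall i, std_normal (X i).

Definition centered (f : R -> R) := [/\ measurable_fun setT f,
  forall x, `|f x| <= `|x| + (relu_mean + 1) &
  (\int[normal_prob 0%R 1%R]_x (f x)%:E = 0)%E].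

Lemma centered_relu : centered (fun x => Num.max x 0 - relu_mean).
Proof.
split; last exact: integral_relu_centered.
  by apply: measurable_funB => //; exact: measurable_relu.
move=> x; apply: le_trans (ler_normB _ _) _.
rewrite (ger0_norm (relu_mean_ge0 R)).
by have := relu_le x; lra.
Qed.

Lemma centered_opp f : centered f -> centered (fun x => - f x).
Proof.
move=> [mf fb f0]; split.
- exact: measurableT_comp.
- by move=> x; rewrite normrN.
- under eq_integral do rewrite EFinN -mulN1e.
  rewrite integralZl ?f0 ?mule0//.
  apply: (@le_exp_moment_integrable _ (relu_mean + 1)) => // x.
  by apply: le_trans (fb x) (le_expR2 _); exact: le_trans (fb x).
Qed.

Lemma centered_pos : centered (fun x => pos_mass - (0 < x)%R%:R).
Proof.
split; last exact: integral_pos_centered.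
  apply: measurable_funB => //.
  rewrite (_ : (fun x => _) = \1_[set x : R | (0 < x)%R]).
    by apply: measurable_indic; exact: measurable_pos.
  by apply/funext => x; rewrite indicE mem_setE.
move=> x; have := pos_mass_gt0 R; have := relu_mean_ge0 R.
have : pos_mass <= 1.
  rewrite -lee_fin fineK ?fin_num_measure//; first by apply: probability_le1; exact: measurable_pos.
  exact: measurable_pos.
have := normr_ge0 x.
by case: (0 < x) => /=; rewrite ?subr0 => *; rewrite ler_norml; lra.
Qed.

Lemma normal_chernoff (f : R -> R) (J : {set I}) (s a : R) : centered f ->
  0 < s <= 1 ->
  (P [set w | (a <= \sum_(i in J) f (X i w))%R] <=
    (expR (#|J|%:R * (s ^+ 2 * mgf_const) - s * a))%:E)%E.
Proof.
move=> [mf fb f0] /andP[s0 s1]; apply: chernoff_sum => // i.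
rewrite (std_normal_integral (f := fun x => expR (s * f x)) (stdX i)).
- by apply: centered_mgf_le => //; rewrite ltW.
- by apply: measurableT_comp => //; exact: measurable_funM.
- by move=> x; exact: expR_ge0.
Qed.

(** Chernoff with s = 1/B: as [B ^+ 2] bounds the number of summands, the quadratic term is at most
    [mgf_const], and the deviation [t * B] yields exp(-t). *)
Lemma normal_chernoff_ln (f : R -> R) (J : {set I}) (B t : R) : centered f ->
  1 <= B -> #|J|%:R <= B ^+ 2 ->
  (P [set w | (t * B <= \sum_(i in J) f (X i w))%R] <=
    (expR (mgf_const - t))%:E)%E.
Proof.
move=> cf B1 JB; have B0 : 0 < B by exact: lt_le_trans B1.
apply: le_trans (@normal_chernoff f J B^-1 (t * B) cf _) _.
  by rewrite invr_gt0 B0 invf_le1.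
rewrite lee_fin ler_expR (_ : B^-1 * (t * B) = t); last by field; rewrite gt_eqF.
rewrite lerD2r mulrA ler_piMl ?mgf_const_ge0//.
by rewrite exprVn ler_pdivrMr ?mul1r// exprn_gt0.
Qed.

End Normal_families.

(** * Ties at positive scores are negligible *)

Section Bad_events.
Context d (T : measurableType d) (R : realType) (P : probability T R).
Context (n q : nat) (v : binvec n).
Notation tuples := (q.+1.-tuple 'I_n).
Context (X : tuples -> {RV P >-> R}).
Hypothesis indX : mutually_independent X.
Hypothesis stdX : forall t, std_normal (X t).

Definition sample w : tensor R q.+1 n := [ffun t => X t w].
Definition relu w t : R := Num.max (sample w t) 0.

Lemma reluE w t : relu w t = Num.max (X t w) 0.
Proof. by rewrite /relu ffunE. Qed.

Lemma measurable_sub_algebra_relu (J : {set tuples}) t : t \in J ->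
  measurable_fun setT (fun w : sub_algebra X J => relu w t).
Proof.
move=> tJ.
have -> : (fun w : sub_algebra X J => relu w t) = (fun w => Num.max (X t w) 0).
  by apply/funext => w; exact: reluE.
exact: (measurable_sub_algebra_comp tJ (@measurable_relu R)).
Qed.

Lemma measurable_relu_coord t : measurable_fun setT (fun w : T => relu w t).
Proof.
have -> : relu^~ t = (fun w => Num.max (X t w) 0).
  by apply/funext => w; exact: reluE.
exact: (measurableT_comp (@measurable_relu R) (measurable_funPT (X t))).
Qed.

(* A tie with positive value determines one entry of one of the two rows. *)
Lemma no_tie_ae : P [set w | ~ no_tie v (relu w)] = 0%E.
Proof.
pose F := (binvec n * 'I_n * 'I_n * tuples)%type.
pose Z p i l t w : R :=
  score (relu w) l p - \sum_(u in rowset q i p :\ t) relu w u.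
pose E (x : F) : set T := let: (p, i, l, t) := x in
  [set w | (i != l /\ t \in rowset q i p) /\ Z p i l t w = X t w].
have rel t : (fun w => relu w t) = (fun w => Num.max (X t w) 0).
  by apply/funext => w; rewrite reluE.
(* [Z] does not read the entry [t]: it is taken out of row [i], and row [l] only has tuples starting
   with [l], which differs from [i]. *)
have mZ p i l t : i != l -> t \in rowset q i p ->
    measurable_fun setT (Z p i l t : sub_algebra X (~: [set t])%SET -> R).
  move=> il tp; apply: measurable_funB.
    apply: measurable_score => u /rowset_head ul.
    apply: measurable_sub_algebra_relu; rewrite !inE.
    by apply: contraNneq il => ut; rewrite -ul ut (rowset_head tp).
  under eq_fun do rewrite big_mkcond.
  apply: measurable_sum => u; have [up|_ //] := boolP (u \in rowset q i p :\ t)%SET.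
  apply: measurable_sub_algebra_relu; rewrite !inE.
  by move: up; rewrite !inE => /andP[].
have E0 x : measurable (E x) /\ P (E x) = 0%E.
  case: x => [[[p i] l] t] /=.
  have [[il tp]|nc] := pselect (i != l /\ t \in rowset q i p); last first.
    rewrite (_ : [set w | _] = set0) ?measure0//.
    by apply/seteqP; split=> w // [].
  rewrite (_ : [set w | _] = [set w | Z p i l t w = X t w]); last first.
    by apply/seteqP; split=> w => [[]|].
  split.
    rewrite (_ : [set w | _] = [set w | Z p i l t w == X t w]).
      apply: measurable_boolP; apply: measurable_fun_eqr => //.
      exact: sub_algebra_measurable_fun (mZ p i l t il tp).
    by apply/seteqP; split=> w /= /eqP.
  apply: (null_diagonal indX (J := (~: [set t])%SET)).
  - by rewrite !inE eqxx.
  - exact: mZ.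
  - by move=> x; exact: std_normal_atomless.
apply/eqP; rewrite -measure_le0.
apply: (@le_trans _ _ (P [set w | exists x, E x w])).
  apply: le_measure; rewrite ?inE.
  - apply: measurableC; apply: measurable_no_tie => t _.
    exact: measurable_relu_coord.
  - by apply: measurable_exists => x; exact: (E0 x).1.
  move=> w /= /existsNP[p] /existsNP[i] /existsNP[l].
  move=> /not_implyP[pi] /not_implyP[pl] /not_implyP[vi] /not_implyP[vl].
  move=> /not_implyP[il] /not_implyP[pos] /negP; rewrite negbK => /eqP tie.
  (* A positive score has a positive entry; there truncation is the identity, so the tie forces
     [X t] to equal [Z]. *)
  have [t tp Xt] : exists2 t, t \in rowset q i p & 0 < X t w.
    apply: contrapT => none; move: pos.
    rewrite /score big1 ?ltxx// => t tp; rewrite reluE; apply/max_idPr.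
    by rewrite leNgt; apply/negP => Xt; apply: none; exists t.
  exists (p, i, l, t); split=> //.
  rewrite /Z -tie /score (big_setD1 t tp) /= addrK reluE.
  exact/max_idPl/ltW.
apply: le_trans (prob_exists_le P _) _; first by move=> x; exact: (E0 x).1.
by rewrite big1// => x _; exact: (E0 x).2.
Qed.

End Bad_events.

(** * Probability of failure for a fixed planted set *)

Section Planted_failure.
Context d (T : measurableType d) (R : realType) (P : probability T R).
Context (n q k : nat) (v : binvec n) (mu c : R).
Notation tuples := (q.+1.-tuple 'I_n).
Context (X : tuples -> {RV P >-> R}).
Hypothesis indX : mutually_independent X.
Hypothesis stdX : forall t, std_normal (X t).
Hypothesis vk : l0norm v = k.
Hypotheses (q0 : (0 < q)%N) (n0 : (0 < n)%N) (k0 : (0 < k)%N).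
Hypotheses (c0 : 0 < c) (ck : c * Num.sqrt n%:R <= k%:R).

Local Notation N := (n%:R : R).
Local Notation D := (Num.sqrt N ^+ q).
Local Notation C := (mgf_const R).
(** The level 4 ln n makes each Chernoff bound of order n^-4, enough for a union over about n^2
    pairs of a ghost state and a planted index. *)
Local Notation t4 := (4 * ln N).

(* Chosen so that Chernoff's bound is at most exp (-2n), which beats the number
   2^n of states. *)
Definition slack : R := (2 + 3 * C) / Num.min 1 (c / 2).

Let outer_slack := slack * D.
Let count_slack := t4 * Num.sqrt (k ^ q)%:R.
Let row_slack := t4 * D.

Let N1 : 1 <= N. Proof. by rewrite ler1n. Qed.
Let sN1 : 1 <= Num.sqrt N. Proof. by rewrite -[leLHS]sqrtr1 ler_wsqrtr. Qed.
Let D1 : 1 <= D. Proof. exact: exprn_ege1. Qed.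
Let D2 : D ^+ 2 = N ^+ q. Proof. by rewrite exprAC sqr_sqrtr. Qed.
Let eps_gt0 : 0 < Num.min 1 (c / 2).
Proof. by rewrite lt_min ltr01 divr_gt0. Qed.

Let t4_ge0 : 0 <= t4. Proof. by rewrite mulr_ge0// ln_ge0. Qed.

Lemma slack_ge0 : 0 <= slack.
Proof.
apply: divr_ge0; last exact: ltW.
by rewrite addr_ge0// mulr_ge0// mgf_const_ge0.
Qed.

Lemma centered_relu_opp : centered (fun x : R => relu_mean R - Num.max x 0).
Proof.
rewrite (_ : (fun x => _) = (fun x => - (Num.max x 0 - relu_mean R))).
  exact: centered_opp (centered_relu R).
by apply/funext => x; rewrite opprB.
Qed.

(** This event and the next two are the failures of the deviation bounds of the deterministic
    analysis. The side conditions belong to the event, which is empty when they do not hold. *)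
Definition outer_event (p : binvec n) : set T :=
  [set w | (included v p /\ (3 * k < 2 * l0norm p)%N) /\
    outer_slack * (l0norm p - k)%:R <=
      \sum_(t in outer_rows q v p) (relu X w t - relu_mean R)].

Definition count_event (l : 'I_n) : set T :=
  [set w | v l /\
    count_slack <= \sum_(t in rowset q l v) (pos_mass R - (0 < sample X w t)%R%:R)].

Definition row_event (p : binvec n) (l : 'I_n) : set T :=
  [set w | v l /\
    row_slack <= \sum_(t in rowset q l p) (relu_mean R - relu X w t)].

(** The number of steps is dictated by the size of [p]. Including [no_tie] makes the events of
    distinct sets of the same size disjoint. *)
Definition ghost_event (p : binvec n) : set T :=
  [set w | (reach (ghost_step v (relu X w)) (n - l0norm p) p /\
    positive_scores v (relu X w) p) /\ no_tie v (relu X w)].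

(** Chernoff with [s] proportional to n / (y D), where y = m - k. Since m > 3k/2, one has m <= 3y,
    which controls the quadratic term, and y >= k/2, which with k >= c sqrt n keeps [s] at most
    1. *)
Lemma prob_outer_event p : (P (outer_event p) <= (expR (- (2 * N)))%:E)%E.
Proof.
have [[vp large]|nc] := pselect (included v p /\ (3 * k < 2 * l0norm p)%N); last first.
  rewrite (_ : outer_event p = set0) ?measure0 ?lee_fin ?expR_ge0//.
  by apply/seteqP; split=> w // [].
set m := l0norm p in large *; set y := (m - k)%:R : R.
have km : (k < m)%N by clear -large; lia.
have y0 : 0 < y by rewrite ltr0n subn_gt0.
have mn : (m <= n)%N by exact: l0norm_le.
pose e := Num.min 1 (c / 2).
have e0 : 0 < e by exact: eps_gt0.
pose s := e * N / (y * D).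
have D0 : 0 < D by exact: lt_le_trans D1.
have e1 : e <= 1 by rewrite ge_min lexx.
have ec : e <= c / 2 by rewrite ge_min lexx orbT.
have s01 : 0 < s <= 1.
  apply/andP; split; first by apply: divr_gt0; apply: mulr_gt0; rewrite // ltr0n.
  rewrite ler_pdivrMr ?mulr_gt0// mul1r.
  have NN : N = Num.sqrt N * Num.sqrt N by rewrite -expr2 sqr_sqrtr.
  have ky : k%:R / 2 <= y :> R.
    by rewrite ler_pdivrMr// -natrM ler_nat; clear -large; lia.
  have DN : Num.sqrt N <= D by rewrite -[leLHS]expr1; apply: ler_weXn2l.
  apply: (@le_trans _ _ (c / 2 * N)); first by rewrite ler_wpM2r.
  rewrite [in leLHS]NN mulrA; apply: ler_pM => //.
  - by apply: mulr_ge0 => //; apply: divr_ge0 => //; exact: ltW.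
  - by apply: le_trans ky; rewrite mulrAC ler_pM2r ?invr_gt0.
have -> : outer_event p = [set w | outer_slack * y <=
    \sum_(t in outer_rows q v p) (Num.max (X t w) 0 - relu_mean R)].
  have S w : \sum_(t in outer_rows q v p) (relu X w t - relu_mean R) =
      \sum_(t in outer_rows q v p) (Num.max (X t w) 0 - relu_mean R)
    by apply: eq_bigr => t _; rewrite reluE.
  by apply/seteqP; split=> w; rewrite /outer_event /= S; [move=> []|split].
apply: le_trans (normal_chernoff indX stdX _ _ (centered_relu R) s01) _.
rewrite lee_fin ler_expR card_outer_rows// vk -/m natrM -/y natrX.
(* Of this gain, 3CN pays for the quadratic term and 2N is left. *)
have -> : s * (outer_slack * y) = (2 + 3 * C) * N.
  rewrite /s /outer_slack /slack -/e; field.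
  by rewrite !gt_eqF// ltW.
suff : y * m%:R ^+ q * (s ^+ 2 * C) <= 3 * C * N by lra.
rewrite mulrA [leRHS]mulrAC; apply: ler_wpM2r; first exact: mgf_const_ge0.
have -> : y * m%:R ^+ q * s ^+ 2 = (m%:R ^+ q / y) * (e ^+ 2 * N ^+ 2) / D ^+ 2.
  by rewrite /s; field; rewrite !gt_eqF.
rewrite D2 ler_pdivrMr ?exprn_gt0 ?ltr0n//.
have m3 : m%:R <= 3 * y :> R.
  by rewrite -natrM ler_nat; clear -large; lia.
have mq : m%:R ^+ q <= 3 * y * N ^+ q.-1 :> R.
  rewrite -[in leLHS](prednK q0) exprS; apply: ler_pM => //.
  by apply: lerXn2r; rewrite ?nnegrE// ler_nat.
have mqy : m%:R ^+ q / y <= 3 * N ^+ q.-1.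
  by rewrite ler_pdivrMr// mulrAC.
have -> : N ^+ q = N * N ^+ q.-1 by rewrite -exprS prednK.
have e2 : e ^+ 2 <= 1 by apply: exprn_ile1 => //; exact: ltW.
have -> : 3 * N * (N * N ^+ q.-1) = 3 * N ^+ q.-1 * (1 * N ^+ 2) by ring.
apply: ler_pM => //.
- by rewrite divr_ge0// ?exprn_ge0// ltW.
- by rewrite mulr_ge0// ?exprn_ge0// ltW.
- by rewrite ler_wpM2r// exprn_ge0.
Qed.

Lemma prob_count_event l : (P (count_event l) <= (expR (C - t4))%:E)%E.
Proof.
have [vl|nvl] := boolP (v l); last first.
  rewrite (_ : count_event l = set0) ?measure0 ?lee_fin ?expR_ge0//.
  by apply/seteqP; split=> w //; rewrite /count_event /= (negbTE nvl) => -[].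
have -> : count_event l = [set w | t4 * Num.sqrt (k ^ q)%:R <=
    \sum_(t in rowset q l v) (pos_mass R - (0 < X t w)%R%:R)].
  have S w : \sum_(t in rowset q l v) (pos_mass R - (0 < sample X w t)%R%:R) =
      \sum_(t in rowset q l v) (pos_mass R - (0 < X t w)%R%:R)
    by apply: eq_bigr => t _; rewrite ffunE.
  by apply/seteqP; split=> w; rewrite /count_event /= S; [move=> []|split].
apply: (@normal_chernoff_ln _ _ _ _ _ _ indX stdX _ _ _ _ (centered_pos R)).
- by rewrite -[leLHS]sqrtr1 ler_wsqrtr// ler1n expn_gt0 k0.
- by rewrite sqr_sqrtr// card_rowset vk.
Qed.

Lemma prob_row_event p l : (P (row_event p l) <= (expR (C - t4))%:E)%E.
Proof.
have [vl|nvl] := boolP (v l); last first.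
  rewrite (_ : row_event p l = set0) ?measure0 ?lee_fin ?expR_ge0//.
  by apply/seteqP; split=> w //; rewrite /row_event /= (negbTE nvl) => -[].
have -> : row_event p l = [set w | t4 * D <=
    \sum_(t in rowset q l p) (relu_mean R - Num.max (X t w) 0)].
  have S w : \sum_(t in rowset q l p) (relu_mean R - relu X w t) =
      \sum_(t in rowset q l p) (relu_mean R - Num.max (X t w) 0)
    by apply: eq_bigr => t _; rewrite reluE.
  by apply/seteqP; split=> w; rewrite /row_event /= S; [move=> []|split].
apply: (@normal_chernoff_ln _ _ _ _ _ _ indX stdX _ _ _ _ centered_relu_opp) => //.
rewrite card_rowset D2 natrX; apply: lerXn2r; rewrite ?nnegrE// ler_nat.
exact: l0norm_le.
Qed.

Let J0 : {set tuples} := [set t | ~~ v (tnth t ord0)]%SET.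
Let J1 : {set tuples} := [set t | v (tnth t ord0)]%SET.

Lemma measurable_ghost_event p :
  measurable (ghost_event p : set (sub_algebra X J0)).
Proof.
have mQ t : ~~ v (tnth t ord0) ->
    measurable_fun setT (fun w : sub_algebra X J0 => relu X w t).
  by move=> vt; apply: measurable_sub_algebra_relu; rewrite inE.
apply: measurable_andP; last exact: measurable_no_tie mQ.
apply: measurable_andP; last by apply: (measurable_positive_scores mQ).
by apply: measurable_reach => p1 p2; apply: (measurable_ghost_step mQ).
Qed.

Lemma measurable_row_event p l :
  measurable (row_event p l : set (sub_algebra X J1)).
Proof.
apply: measurable_and_cst => vl; apply: measurable_leP => //.
rewrite (_ : (fun w => _) =
  (fun w : sub_algebra X J1 => score (fun t => relu_mean R - relu X w t) l p))//.
apply: measurable_score => t /rowset_head tl.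
apply: measurable_funB => //; apply: measurable_sub_algebra_relu.
by rewrite inE tl.
Qed.

(** The ghost run reads the entries in [J0], the planted rows those in [J1], so the two events are
    independent. Keeping the factor [P (ghost_event p)] avoids paying for all 2^n sets. *)
Lemma prob_ghost_row p l : (P (ghost_event p `&` row_event p l) <=
  P (ghost_event p) * (expR (C - t4))%:E)%E.
Proof.
have -> : (P (ghost_event p `&` row_event p l) =
    P (ghost_event p) * P (row_event p l))%E.
  apply: (sub_algebra_indep indX (J1 := J0) (J2 := J1)).
  - rewrite -setI_eq0; apply/eqP/setP => t; rewrite !inE.
    by case: (v _).
  - exact: measurable_ghost_event.
  - exact: measurable_row_event.
by apply: lee_wpmul2l; rewrite ?measure_ge0 ?prob_row_event.
Qed.

(** For each of the n + 1 sizes the events are disjoint, so their probabilities add up to at most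
    1. *)
Lemma sum_prob_ghost : (\sum_(p : binvec n) P (ghost_event p) <= n.+1%:R%:E)%E.
Proof.
have size (p : binvec n) : (l0norm p < n.+1)%N.
  by rewrite ltnS l0norm_le.
rewrite (partition_big (fun p => Ordinal (size p)) predT)//=.
have -> : n.+1%:R%:E = (\sum_(m < n.+1) 1 : \bar R)%E.
  by rewrite sumEFin sumr_const card_ord.
apply: lee_sum => m _; rewrite big_mkcond /=.
pose E p : set T := [set w | l0norm p = m /\ ghost_event p w].
rewrite (eq_bigr (P \o E)).
  apply: prob_disjoint_le1.
    move=> p; apply: measurable_and_cst => _.
    exact: sub_algebra_measurable (measurable_ghost_event p).
  move=> p s w [pm [[rp pp] nt]] [sm [[rs _] _]].
  rewrite pm in rp; rewrite sm in rs.
  apply: (ghost_reach_unique _ nt rp pp rs) => t.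
  by rewrite /relu le_max lexx orbT.
move=> p _; rewrite -val_eqE /=; case: eqP => [pm|pm].
  by congr (P _); apply/seteqP; split=> w; [|case].
by rewrite -[LHS](measure0 P); congr (P _); apply/seteqP; split=> w // [].
Qed.

Definition planted_tensor w : tensor R q.+1 n :=
  [ffun t => mu * tpow q.+1 (vec R v) t + sample X w t].

(** Stated over the algebra of the noise, so that independence from the planted vector can be
    applied to such events. *)
Lemma measurable_output (G : binvec n -> Prop) :
  measurable ([set w | exists s, peeling_output k (planted_tensor w) s /\ G s] :
    set (sub_algebra X [set: tuples]%SET)).
Proof.
apply: measurable_exists => s.
rewrite (_ : [set w | _] = [set w | G s /\ reach
    (peel_step (pos_part (planted_tensor w))) (n - (3 * k) %/ 2) s]); last first.
  by apply/seteqP; split=> w /=; rewrite /peeling_output -reachP; tauto.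
apply: measurable_and_cst => _; apply: measurable_reach => p1 p2.
apply: measurable_peel_step => t.
rewrite (_ : (fun w => _) = (fun w : sub_algebra X [set: tuples]%SET =>
  Num.max (mu * tpow q.+1 (vec R v) t + X t w) 0)); last first.
  by apply/funext => w; rewrite 2!ffunE; congr (Num.max (_ + _) _); exact: ffunE.
apply: (@measurable_sub_algebra_comp _ _ _ _ _ X [set: tuples]%SET
  (fun x => Num.max (mu * tpow q.+1 (vec R v) t + x) 0)); first by rewrite inE.
apply: (measurableT_comp (@measurable_relu R)).
exact: measurable_funD.
Qed.

Hypothesis mu0 : 0 < mu.
Hypothesis signal : slack * D + t4 * D <
  mu * (pos_mass R * (k ^ q)%:R - t4 * Num.sqrt (k ^ q)%:R).

Definition failure_event : set T :=
  [set w | exists s, peeling_output k (planted_tensor w) s /\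
    ~ (included v s /\ (l0norm s + (n - (3 * k) %/ 2) = n)%N)].

(** Failure forces a positive tie or one of three bad events: an outer event (2^n sets), a count
    event (n indices), or a row event at a visited ghost state. *)
Lemma prob_failure : (P failure_event <=
  (expR (- N) + 3 * N ^+ 2 * expR (C - t4))%:E)%E.
Proof.
pose U0 := [set w | ~ no_tie v (relu X w)].
pose U1 := [set w | exists p, outer_event p w].
pose U2 := [set w | exists l, count_event l w].
pose U3 := [set w | exists pl : binvec n * 'I_n,
  (ghost_event pl.1 `&` row_event pl.1 pl.2) w].
have mR := measurable_relu_coord X.
have mU0 : measurable U0.
  by apply: measurableC; apply: measurable_no_tie => t _; exact: mR.
have mE1 p : measurable (outer_event p).
  apply: measurable_and_cst => _; apply: measurable_leP => //.
  under eq_fun do rewrite big_mkcond.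
  apply: measurable_sum => t; case: (t \in _) => //.
  exact: measurable_funB.
have mU1 : measurable U1 by exact: measurable_exists.
have mE2 l : measurable (count_event l).
  apply: measurable_and_cst => _; apply: measurable_leP => //.
  under eq_fun do rewrite big_mkcond.
  apply: measurable_sum => t; case: (t \in _) => //.
  have [mf _ _] := centered_pos R.
  rewrite (_ : (fun w => _) = (fun w => pos_mass R - (0 < X t w)%R%:R)).
    exact: (measurableT_comp mf (measurable_funPT (X t))).
  by apply/funext => w; rewrite ffunE.
have mU2 : measurable U2 by exact: measurable_exists.
have mE3 (pl : binvec n * 'I_n) :
    measurable (ghost_event pl.1 `&` row_event pl.1 pl.2).
  apply: measurableI; apply: sub_algebra_measurable.
    exact: measurable_ghost_event.
  exact: measurable_row_event.
have mU3 : measurable U3 by exact: measurable_exists.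
have sub : failure_event `<=` U0 `|` (U1 `|` (U2 `|` U3)).
  move=> w [s [out bad]]; apply: contrapT => /not_orP[nU0 /not_orP[nU1]].
  move=> /not_orP[nU2 nU3]; apply: bad.
  move/contrapT: nU0 => nt.
  apply: (peeling_output_contains (c0 := relu_mean R) vk mu0 _ _ _ _ signal out).
  - have D0 : 0 <= D by exact: le_trans D1.
    by rewrite addr_ge0// mulr_ge0// slack_ge0.
  - move=> p vp large; rewrite leNgt; apply/negP => big; apply: nU1.
    by exists p; split; [split|exact: ltW].
  - move=> l vl; rewrite leNgt; apply/negP => big; apply: nU2.
    by exists l; split; [|exact: ltW].
  - move=> t p l rp pp vl; rewrite leNgt; apply/negP => big; apply: nU3.
    exists (p, l); split; last by split; [|exact: ltW].
    split; [split|] => //.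
    have := reach_l0norm (@ghost_step_removing _ _ _ _ _) rp.
    by move=> pt; rewrite (_ : (n - l0norm p)%N = t)//; clear -pt; lia.
have P1 : (P U1 <= (expR (- N))%:E)%E.
  apply: le_trans (prob_exists_le P mE1) _.
  apply: (@le_trans _ _ (\sum_(p : binvec n) (expR (- (2 * N)))%:E)%E).
    by apply: lee_sum => p _; exact: prob_outer_event.
  (* 2^n exp(-2n) <= exp(-n), because 2 <= e. *)
  rewrite sumEFin lee_fin sumr_const card_ffun card_bool card_ord.
  rewrite -[leLHS]mulr_natl natrX (_ : - (2 * N) = - N + - N); last by ring.
  rewrite expRD mulrA ler_piMl ?expR_ge0// expRN ler_pdivrMr ?expR_gt0// mul1r.
  rewrite -[N]mulr1 expRM_natl; apply: lerXn2r; rewrite ?nnegrE ?expR_ge0//.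
  by apply: le_trans (expR_ge1Dx 1); rewrite -natr1.
have P2 : (P U2 <= (N * expR (C - t4))%:E)%E.
  apply: le_trans (prob_exists_le P mE2) _.
  apply: (@le_trans _ _ (\sum_(l < n) (expR (C - t4))%:E)%E).
    by apply: lee_sum => l _; exact: prob_count_event.
  by rewrite sumEFin lee_fin sumr_const card_ord [leRHS]mulr_natl.
have P3 : (P U3 <= (n.+1%:R * N * expR (C - t4))%:E)%E.
  apply: le_trans (prob_exists_le P mE3) _.
  apply: (@le_trans _ _ (\sum_(p : binvec n) \sum_(l < n)
      (P (ghost_event p) * (expR (C - t4))%:E))%E).
    rewrite pair_big /=; apply: lee_sum => pl _; exact: prob_ghost_row.
  apply: (@le_trans _ _ (\sum_(p : binvec n)
      P (ghost_event p) * (N * expR (C - t4))%:E)%E).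
    apply: lee_sum => p _; rewrite -ge0_sume_distrr; last first.
      by move=> l _; rewrite lee_fin expR_ge0.
    by rewrite sumEFin sumr_const card_ord (mulr_natl (expR _)).
  rewrite -ge0_sume_distrl; last by move=> p _; exact: measure_ge0.
  rewrite -mulrA [X in (_ <= X)%E]EFinM; apply: lee_wpmul2r; last exact: sum_prob_ghost.
  by rewrite lee_fin mulr_ge0// expR_ge0.
apply: le_trans (le_measure _ _ _ sub) _; rewrite ?inE.
- exact: sub_algebra_measurable (measurable_output _).
- by do 3 (apply: measurableU => //).
apply: le_trans (measureU2 _ _ _) _ => //; first by do 2 (apply: measurableU => //).
rewrite [X in (X + _)%E](no_tie_ae v indX stdX) add0e.
apply: le_trans (measureU2 _ _ _) _ => //; first exact: measurableU.
rewrite EFinD; apply: leeD => //.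
apply: le_trans (measureU2 _ _ _) _ => //.
apply: le_trans (leeD P2 P3) _; rewrite -EFinD lee_fin -mulrDl.
(* N + (N + 1) N <= 3 N^2 for N >= 1. *)
rewrite ler_wpM2r ?expR_ge0// -(natr1 n); have := N1; nra.
Qed.

End Planted_failure.

(** * The uniform prior on planted sets *)

Lemma Theta_gt0 n k : (k <= n)%N -> (0 < #|Theta n k|)%N.
Proof.
move=> kn.
have : (0 < #|[set A : {set 'I_n} | A \subset [set: 'I_n]%SET & #|A| == k]%SET|)%N.
  by rewrite cards_draws cardsT card_ord bin_gt0.
rewrite !card_gt0 => /set0Pn[A]; rewrite inE => /andP[_ /eqP Ak].
apply/set0Pn; exists [ffun i => i \in A]; rewrite inE -Ak /l0norm.
by apply/eqP/eq_card => i; rewrite inE ffunE.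
Qed.

(** The prescribed masses on [A] already add up to 1, so disjointness leaves nothing for the other
    values. *)
Lemma uniform_on_support d (T : measurableType d) (R : realType)
    (P : probability T R) (F : finType) (A : {set F}) (Y : T -> F) :
  (0 < #|A|)%N -> uniform_on P A Y ->
  (\sum_(x in A) P (Y @^-1` [set x]) = 1)%E /\
  forall x, x \notin A -> P (Y @^-1` [set x]) = 0%E.
Proof.
move=> A0 [mY unif].
have S1 : (\sum_(x in A) P (Y @^-1` [set x]) = 1)%E.
  rewrite (eq_bigr (fun=> (#|A|%:R^-1 : R)%:E)) => [|x xA]; last exact: unif.
  rewrite sumEFin sumr_const -[_ *+ _]mulr_natr mulVf// pnatr_eq0.
  by rewrite -lt0n.
split=> // x xA.
have := @prob_disjoint_le1 _ _ _ P _ (fun x => Y @^-1` [set x]) mY.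
have dis i j w : (Y @^-1` [set i]) w -> (Y @^-1` [set j]) w -> i = j.
  by rewrite /preimage /= => <- <-.
move=> /(_ dis); rewrite (bigID (mem A)) /= S1.
have nn : (0 <= \sum_(i | i \notin A) P (Y @^-1` [set i]))%E.
  by apply: sume_ge0.
move=> le1.
have s0 : (\sum_(i | i \notin A) P (Y @^-1` [set i]) <= 0)%E.
  by move: le1; rewrite -{2}(adde0 1%E) leeD2lE.
apply/eqP; rewrite eq_le measure_ge0 andbT; apply: le_trans s0.
rewrite (bigD1 x)//= leeDl//; exact: sume_ge0.
Qed.

(** * Averaging over the random planted set *)

Section Mixture.
Context d (T : measurableType d) (R : realType) (P : probability T R).
Context (n q k : nat) (lam c : R).
Notation tuples := (q.+1.-tuple 'I_n).
Context (theta : T -> binvec n) (X : tuples -> {RV P >-> R}).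
Hypothesis theta_unif : uniform_on P (Theta n k) theta.
Hypothesis indX : mutually_independent X.
Hypothesis stdX : forall t, std_normal (X t).
Hypothesis theta_indep : independent_of theta X.
Hypotheses (q0 : (0 < q)%N) (n0 : (0 < n)%N) (k0 : (0 < k)%N).
Hypothesis kn : (3 * k <= 2 * n)%N.
Hypotheses (c0 : 0 < c) (ck : c * Num.sqrt n%:R <= k%:R).

Local Notation N := (n%:R : R).
Local Notation D := (Num.sqrt N ^+ q).
Let mu : R := lam / (k%:R `^ (q.+1%:R / 2)).

Hypothesis mu0 : 0 < mu.
Hypothesis signal : slack c * D + 4 * ln N * D <
  mu * (pos_mass R * (k ^ q)%:R - 4 * ln N * Num.sqrt (k ^ q)%:R).

Definition recovers (s v : binvec n) : Prop :=
  (l0norm s)%:R <= 3 / 2 * k%:R :> R /\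
  1 / 8 * k%:R <= dotv (vec R s) (vec R v).

Definition success : set T :=
  [set w | forall s : binvec n,
    peeling_output k (observation k lam (theta w) [ffun t => X t w]) s ->
    recovers s (theta w)].

(** Containing [v] gives overlap exactly [k], well above k/8, and floor(3k/2) indices remain. *)
Lemma included_recovers s v : v \in Theta n k -> included v s ->
  (l0norm s + (n - (3 * k) %/ 2) = n)%N -> recovers s v.
Proof.
rewrite inE => /eqP vk vs sn; split.
  rewrite (_ : l0norm s = ((3 * k) %/ 2)%N).
    rewrite mulrAC ler_pdivlMr// -!natrM ler_nat; exact: leq_trunc_div.
  (* [kn] ensures that the subtraction from [n] is not truncated at zero. *)
  have := leq_div2r 2 kn; rewrite mulKn// => kn2.
  by move: sn; set x := (_ %/ _)%N in kn2 *; clear -kn2; lia.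
rewrite (_ : dotv _ _ = k%:R); last first.
  rewrite /dotv -vk /l0norm -sum1_card natr_sum [RHS]big_mkcond.
  apply: eq_bigr => i _; rewrite !mxE inE.
  by have [vi|_] := boolP (v i); rewrite ?mulr0// vs// mulr1.
have : 0 <= k%:R :> R by []; lra.
Qed.

Definition error_event v : set T :=
  [set w | exists s, peeling_output k (planted_tensor v mu X w) s /\
    ~ recovers s v].

Lemma measurable_output_event v (G : binvec n -> Prop) :
  measurable [set w | exists s, peeling_output k (planted_tensor v mu X w) s /\ G s].
Proof. exact: (sub_algebra_measurable (measurable_output k v mu (X := X) G)). Qed.

Lemma prob_error_event v : v \in Theta n k ->
  (P (error_event v) <=
    (expR (- N) + 3 * N ^+ 2 * expR (mgf_const R - 4 * ln N))%:E)%E.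
Proof.
move=> vT; have vk : l0norm v = k by move: vT; rewrite inE => /eqP.
apply: le_trans (prob_failure indX stdX vk q0 n0 k0 c0 ck mu0 signal).
apply: le_measure; rewrite ?inE.
- exact: measurable_output_event.
- exact: measurable_output_event.
move=> w [s [out bad]]; exists s; split=> // -[vs sn]; apply: bad.
exact: included_recovers.
Qed.

Lemma successC : ~` success = [set w | exists v, theta w = v /\ error_event v w].
Proof.
apply/seteqP; split=> w /=.
  move=> /existsNP[s /not_implyP[out bad]].
  by exists (theta w); split=> //; exists s; split.
by move=> [_ [<- [s [out bad]]]] /(_ s out).
Qed.

Lemma measurable_error v : measurable (theta @^-1` [set v] `&` error_event v).
Proof.
apply: measurableI; first exact: theta_unif.1.
exact: measurable_output_event.
Qed.

(** Split the failure by the value of [theta]. Each [error_event v] depends on the noise only, so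
    its probability multiplies that of [theta] being [v], and the latter sum to 1. *)
Lemma prob_success :
  (1 - (expR (- N) + 3 * N ^+ 2 * expR (mgf_const R - 4 * ln N))%:E <=
    P success)%E.
Proof.
set delta := expR _ + _.
have mC : measurable (~` success).
  by rewrite successC; apply: measurable_exists => v; exact: measurable_error.
have -> : P success = (1 - P (~` success))%E.
  by rewrite -probability_setC// setCK.
have kn' : (k <= n)%N by move: kn; clear; lia.
have [S1 S0] := uniform_on_support (Theta_gt0 kn') theta_unif.
apply: leeB => //; rewrite successC.
apply: le_trans (prob_exists_le P measurable_error) _.
apply: (@le_trans _ _ (\sum_(v in Theta n k)
    (P (theta @^-1` [set v]) * delta%:E))%E).
  rewrite (bigID (mem (Theta n k))) /= [X in (_ + X)%E]big1 ?adde0; last first.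
    move=> v vT; apply/eqP; rewrite -measure_le0 -(S0 v vT).
    apply: le_measure; rewrite ?inE//; first exact: measurable_error.
    exact: theta_unif.1.
  apply: lee_sum => v vT.
  have -> : (P (theta @^-1` [set v] `&` error_event v) =
      P (theta @^-1` [set v]) * P (error_event v))%E.
    apply: theta_indep; apply: sub_algebra_sigma_gen.
    exact: measurable_output.
  by apply: lee_wpmul2l; rewrite ?measure_ge0 ?prob_error_event.
rewrite -ge0_sume_distrl; last by move=> v _; exact: measure_ge0.
by rewrite S1 mul1e.
Qed.

Lemma measurable_success : measurable success.
Proof.
rewrite -(setCK success); apply: measurableC; rewrite successC.
by apply: measurable_exists => v; exact: measurable_error.
Qed.

End Mixture.

(** * Numerical estimates for large n *)

Section Asymptotics.
Context (R : realType).
Implicit Types (n q k : nat) (c p x : R).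

(** With x = y^8, ln x = 8 ln y <= 8 y. The eighth root is of lower order than sqrt k, which is at
    least of order n^(1/4). *)
Lemma ln_le_root8 x : 1 <= x -> ln x <= 8 * Num.sqrt (Num.sqrt (Num.sqrt x)).
Proof.
move=> x1; set y := Num.sqrt _.
have s1 (z : R) : 1 <= z -> 1 <= Num.sqrt z.
  by move=> z1; rewrite -[leLHS]sqrtr1 ler_wsqrtr.
have y1 : 1 <= y by do 3 apply: (s1).
have x0 : 0 <= x by exact: le_trans x1.
have -> : x = y ^+ 8.
  by rewrite (exprM y 2 4) /y sqr_sqrtr// (exprM _ 2 2) sqr_sqrtr// sqr_sqrtr.
have y0 : 0 < y by exact: lt_le_trans y1.
rewrite lnXn// -[leLHS]mulr_natl ler_wpM2l//; apply: ltW; exact: ln_sublinear.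
Qed.

Lemma le_root4 (M x : R) : 0 <= M -> M ^+ 4 <= x -> M <= Num.sqrt (Num.sqrt x).
Proof.
move=> M0 Mx.
have <- : Num.sqrt (Num.sqrt (M ^+ 4)) = M.
  by rewrite (exprM M 2 2) sqrtr_sqr ger0_norm ?sqr_ge0// sqrtr_sqr ger0_norm.
by rewrite !ler_wsqrtr.
Qed.

(** This keeps the fluctuation in the number of positive planted entries below half of its mean.
    After squaring, with y the eighth root of n, it reads 64^2 y^2 <= p^2 c y^4. *)
Lemma ln_le_planted n q k c p : (0 < n)%N -> (0 < q)%N -> (0 < k)%N ->
  0 < c -> 0 < p -> c * Num.sqrt n%:R <= k%:R ->
  (64 / p) ^+ 2 / c <= Num.sqrt (Num.sqrt n%:R) ->
  8 * ln n%:R <= p * Num.sqrt (k ^ q)%:R.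
Proof.
move=> n0 q0 k0 c0 p0 ck; rewrite ler_pdivrMr// => big.
have := @ln_le_root8 n%:R; rewrite ler1n => /(_ n0); set y := Num.sqrt _ => ln_y.
have y0 : 0 <= y by exact: sqrtr_ge0.
have y2 : y ^+ 2 = Num.sqrt (Num.sqrt n%:R) by rewrite sqr_sqrtr.
have y4 : y ^+ 2 * y ^+ 2 = Num.sqrt n%:R by rewrite y2 -expr2 sqr_sqrtr.
apply: (@le_trans _ _ (64 * y)); first by lra.
rewrite -ler_sqr ?nnegrE; [|by rewrite mulr_ge0|by rewrite mulr_ge0 ?sqrtr_ge0 ?(ltW p0)].
rewrite !exprMn [Num.sqrt (k ^ q)%:R ^+ 2]sqr_sqrtr//.
have kq : k%:R <= (k ^ q)%:R :> R by rewrite ler_nat -[leqLHS]expn1 leq_pexp2l.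
apply: (@le_trans _ _ (p ^+ 2 * (c * (y ^+ 2 * y ^+ 2)))); last first.
  rewrite y4; apply: ler_wpM2l; first exact/exprn_ge0/ltW.
  exact: le_trans ck kq.
rewrite (_ : 64 ^+ 2 = p ^+ 2 * (64 / p) ^+ 2); last first.
  by field; rewrite gt_eqF.
rewrite -mulrA; apply: ler_wpM2l; first exact/exprn_ge0/ltW.
rewrite [leRHS]mulrA; apply: ler_wpM2r; first exact: sqr_ge0.
by rewrite [leRHS]mulrC y2.
Qed.

(** Since r - 1 = r/2 + (r/2 - 1), the total signal of a planted row is lambda k^(r/2 - 1), which
    the assumption on [lam] bounds from below. *)
Lemma signal_strength n q k (lam : R) : (0 < k)%N ->
  ln n%:R ^+ 2 * (n%:R `^ ((q.+1%:R - 1) / 2) / k%:R `^ (q.+1%:R / 2 - 1)) <= lam ->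
  ln n%:R ^+ 2 * Num.sqrt n%:R ^+ q <=
    lam / (k%:R `^ (q.+1%:R / 2)) * (k ^ q)%:R.
Proof.
move=> k0 lam_ge.
have kR : 0 < k%:R :> R by rewrite ltr0n.
have -> : Num.sqrt n%:R ^+ q = n%:R `^ ((q.+1%:R - 1) / 2) :> R.
  by rewrite -natr1 addrK mulrC powRrM powR12_sqrt// powR_mulrn// sqrtr_ge0.
have -> : (k ^ q)%:R = k%:R `^ (q.+1%:R / 2) * k%:R `^ (q.+1%:R / 2 - 1) :> R.
  rewrite natrX -powR_mulrn// -powRD; last by apply/implyP => _; rewrite gt_eqF.
  congr (_ `^ _).
  by rewrite -natr1; field.
rewrite mulrA divfK ?gt_eqF ?powR_gt0//.
by rewrite -ler_pdivrMr ?powR_gt0// -mulrA.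
Qed.

(** [l] plays ln n. The left side is at most l (s + 4) D, and a second factor [l] beats the
    constants; on the right, at least half of [p * K] survives the fluctuation. *)
Lemma signal_dominates (s p l D S K mu : R) : 0 < p -> 0 <= s -> 0 < D ->
  1 + 2 / p * (s + 4) <= l -> 0 <= S -> K = S ^+ 2 -> 8 * l <= p * S ->
  0 <= mu -> l ^+ 2 * D <= mu * K ->
  s * D + 4 * l * D < mu * (p * K - 4 * l * S).
Proof.
move=> p0 s0 D0 ls S0 -> lS mu0 lD.
have l1 : 1 <= l.
  apply: le_trans ls; rewrite lerDl mulr_ge0//; last exact: addr_ge0.
  by rewrite divr_ge0// ltW.
apply: (@lt_le_trans _ _ (p / 2 * (l ^+ 2 * D))).
  rewrite -mulrDl mulrA ltr_pM2r//.
  have pl : s + 4 < p / 2 * l.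
    apply: (@lt_le_trans _ _ (p / 2 * (1 + 2 / p * (s + 4)))).
      rewrite (_ : p / 2 * _ = p / 2 + (s + 4)); first by lra.
      by field; rewrite gt_eqF.
    by rewrite ler_wpM2l// divr_ge0// ltW.
  apply: (@le_lt_trans _ _ (l * (s + 4))); first by nra.
  by rewrite expr2 mulrA [ltRHS]mulrC ltr_pM2l// (lt_le_trans _ l1).
apply: (@le_trans _ _ (p / 2 * (mu * S ^+ 2))).
  by rewrite ler_wpM2l// divr_ge0// ltW.
have : mu * (S * (8 * l)) <= mu * (S * (p * S)).
  by do 2 (apply: ler_wpM2l => //).
nra.
Qed.

Lemma failure_rate n (C : R) : (0 < n)%N ->
  expR (- n%:R) + 3 * n%:R ^+ 2 * expR (C - 4 * ln n%:R) <=
    (1 + 3 * expR C) / n%:R.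
Proof.
move=> n0; have N0 : 0 < n%:R :> R by rewrite ltr0n.
have N1 : 1 <= n%:R :> R by rewrite ler1n.
rewrite [leRHS]mulrDl mul1r lerD//.
  rewrite expRN lef_pV2 ?posrE ?expR_gt0//.
  by apply: le_trans (expR_ge1Dx _); rewrite lerDr.
have -> : expR (C - 4 * ln n%:R) = expR C / n%:R ^+ 4.
  by rewrite expRB expRM_natl lnK.
rewrite (_ : 3 * n%:R ^+ 2 * _ = 3 * expR C / n%:R * n%:R^-1); last first.
  by field; rewrite gt_eqF.
by rewrite ler_piMr ?invf_le1// divr_ge0// mulr_ge0// expR_ge0.
Qed.

Lemma cvg_one_sub_inv (K : R) : (1 - (K / n%:R)%:E)%E @[n --> \oo] --> (1 : \bar R)%E.
Proof.
have -> : (fun n => 1 - (K / n%:R)%:E)%E = EFin \o (fun n => 1 - K / n%:R).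
  by apply/funext => n; rewrite /= EFinB.
apply: cvg_EFin; first by apply: nearW.
rewrite [X in _ --> X](_ : _ = 1 - K * 0); last by rewrite mulr0 subr0.
apply: cvgB; first exact: cvg_cst.
apply: cvgM; first exact: cvg_cst.
rewrite -(cvg_shiftS (fun n => n%:R^-1 : R)) /=; exact: cvg_harmonic.
Qed.

End Asymptotics.

Unset Implicit Arguments.


(** * Choice of the polylogarithmic factor and passage to the limit *)

Theorem theorem2p4 (R : realType) (r : nat) (hr : (2 <= r)%N) :
  exists L : nat -> R, polylogarithmic L /\
  forall (k : nat -> nat) (lam : nat -> R)
    (d : nat -> measure_display) (T : forall n, measurableType (d n))
    (P : forall n, probability (T n) R)
    (theta : forall n, T n -> binvec n)
    (W : forall n, r.-tuple 'I_n -> {RV (P n) >-> R}),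
  (fun n => (k n)%:R : R^o) =Omega_\oo (fun n => Num.sqrt n%:R : R^o) ->
  (forall n, (k n)%:R <= 2 / 3 * n%:R :> R) ->
  (forall n, uniform_on (P n) (Theta n (k n)) (theta n)) ->
  (forall n t, std_normal (W n t)) ->
  (forall n, mutually_independent (W n)) ->
  (forall n, independent_of (theta n) (W n)) ->
  (\forall n \near \oo,
     L n * (n%:R `^ ((r%:R - 1) / 2) / (k n)%:R `^ (r%:R / 2 - 1)) <= lam n) ->
  P n [set w | forall s : binvec n,
         peeling_output (k n)
           (observation (k n) (lam n) (theta n w) [ffun t => W n t w]) s ->
         (l0norm s)%:R <= 3 / 2 * (k n)%:R :> R /\
         1 / 8 * (k n)%:R <= dotv (vec R s) (vec R (theta n w))]
    @[n --> \oo] --> 1%E.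
Proof.
case: r hr => [//|q]; rewrite ltnS => q0.
(* One logarithm matches the deviations. The other eventually exceeds every constant, so the factor
   can be fixed before the constant [c] hidden in the growth of [k] is known. *)
exists (fun n => ln n%:R ^+ 2); split.
  exists 2%N; apply/eqO_exP; exists 1 => //.
  by apply: nearW => n; rewrite mul1r.
move=> k lam d T P theta W kOmega k23 unif stdW indW indT lam_ge.
have [c c0 ck] : exists2 c : R, 0 < c &
    \forall n \near \oo, c * Num.sqrt n%:R <= (k n)%:R.
  move: kOmega; rewrite eqOmegaE eqOmegaO => /eqO_exP[C C0 HC].
  exists C^-1; first by rewrite invr_gt0.
  near=> n; rewrite mulrC ler_pdivrMr// mulrC.
  have : `|Num.sqrt n%:R : R^o| <= C * `|(k n)%:R : R^o| by near: n.
  by rewrite !ger0_norm.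
have [p p0 pE] : exists2 p, 0 < p & p = pos_mass R.
  by exists (pos_mass R) => //; exact: pos_mass_gt0.
pose K := 1 + 3 * expR (mgf_const R).
(* The success probability lies between 1 - K/n and 1 for large n. *)
apply: (@squeeze_cvge _ _ _ _ (fun n => 1 - (K / n%:R)%:E)%E _ (fun=> 1%E)).
- near=> n.
  have n0 : (0 < n)%N by near: n; exact: nbhs_infty_gt.
  have ckn : c * Num.sqrt n%:R <= (k n)%:R by near: n.
  have k0 : (0 < k n)%N.
    by rewrite -(ltr0n R); apply: lt_le_trans ckn; rewrite mulr_gt0// sqrtr_gt0 ltr0n.
  have kn : (3 * k n <= 2 * n)%N.
    have := k23 n; rewrite mulrAC ler_pdivlMr// -!natrM ler_nat.
    by rewrite mulnC.
  have lnn : 1 + 2 / p * (slack c + 4) <= ln n%:R.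
    rewrite -ler_expR lnK ?posrE ?ltr0n//.
    by near: n; exact: nbhs_infty_ger.
  have root : (64 / p) ^+ 2 / c <= Num.sqrt (Num.sqrt n%:R).
    apply: le_root4; first by apply: divr_ge0; [exact: sqr_ge0|exact: ltW].
    by near: n; exact: nbhs_infty_ger.
  have lamn : ln n%:R ^+ 2 * (n%:R `^ ((q.+1%:R - 1) / 2) /
      (k n)%:R `^ (q.+1%:R / 2 - 1)) <= lam n by near: n.
  have strength := signal_strength k0 lamn.
  have ln_small := ln_le_planted n0 q0 k0 c0 p0 ckn root.
  have sc0 : 0 <= slack c := slack_ge0 c0.
  have l0 : 0 < ln n%:R :> R.
    apply: lt_le_trans lnn; rewrite ltr_wpDr// mulr_ge0//; last exact: addr_ge0.
    by rewrite divr_ge0// ltW.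
  have D0 : 0 < Num.sqrt n%:R ^+ q :> R by rewrite exprn_gt0// sqrtr_gt0 ltr0n.
  have mu0 : 0 < lam n / ((k n)%:R `^ (q.+1%:R / 2)).
    have : 0 < lam n / ((k n)%:R `^ (q.+1%:R / 2)) * (k n ^ q)%:R.
      by apply: lt_le_trans strength; rewrite mulr_gt0// exprn_gt0.
    by rewrite pmulr_lgt0// ltr0n expn_gt0 k0.
  have signal := signal_dominates p0 sc0 D0 lnn (sqrtr_ge0 _)
    (esym (sqr_sqrtr (ler0n _ _))) ln_small (ltW mu0) strength.
  rewrite pE in signal.
  have mS := @measurable_success _ _ _ _ _ _ _ (lam n) _ (W n) (unif n).
  rewrite (probability_le1 (P n) mS) andbT.
  apply: le_trans (prob_success (unif n) (indW n) (stdW n) (indT n) q0 n0 k0 kn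
    c0 ckn mu0 signal).
  by rewrite leeB// lee_fin failure_rate.
- exact: cvg_one_sub_inv.
- exact: cvg_cst.
Unshelve. all: by end_near.
Qed.
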